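(* An NBW $\mathcal N$ over $\Sigma$ is good-for-MDPs (GFM) if and only if, for every finite labelled Markov chain $\mathcal M$ with labels in $\Sigma$ and every initial state $s_0$ of $\mathcal M$, $\mathrm{PSyn}^{\mathcal M}_{\mathcal N}(s_0)=\mathrm{PSem}^{\mathcal M}_{\mathcal N}(s_0)$.
   Context: An NBW (nondeterministic Büchi word automaton) is $\mathcal N=(\Sigma,Q,q_0,\delta,F)$ with finite alphabet $\Sigma$, finite state set $Q$, initial state $q_0$, transition function $\delta:Q\times\Sigma\to 2^Q$ and set of final states $F\subseteq Q$. A run on $w=w_0w_1\dots\in\Sigma^\omega$ is a sequence $q_0q_1\dots$ with $q_{i+1}\in\delta(q_i,w_i)$; it is accepting if it visits $F$ infinitely often, and $\mathcal L(\mathcal N)$ is the set of words having an accepting run. A finite state-labelled MDP is $\mathcal M=\langle S,\mathrm{Act},P,\Sigma,\ell\rangle$ with finite state set $S$, finite action set $\mathrm{Act}$, partial transition function $P:S\times\mathrm{Act}\rightharpoonup\mathrm{Dist}(S)$ and labelling $\ell:S\to\Sigma$; it is a Markov chain (MC) if every state has exactly one available action. A strategy maps finite runs to probability distributions over the actions available at the last state; a strategy $\mu$ and start state $s$ induce a probability measure $\Pr^\mu_s$ on infinite runs. For an infinite run $r=s_0m_1s_1\dots$ let $\ell(r)=\ell(s_0)\ell(s_1)\dots$. Semantic satisfaction: $\mathrm{PSem}^{\mathcal M}_{\mathcal N}(s)=\sup_\mu\Pr^\mu_s\{r:\ell(r)\in\mathcal L(\mathcal N)\}$. The product $\mathcal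 M\times\mathcal N$ is the MDP with states $S\times Q$ and actions $\mathrm{Act}\times Q$, where at state $(s,q)$, for each action $m$ available at $s$ and each $q'\in\delta(q,\ell(s))$, the action $(m,q')$ is available and leads to $(s',q')$ with probability $P(s,m)(s')$. Syntactic satisfaction: $\mathrm{PSyn}^{\mathcal M}_{\mathcal N}(s)$ is the supremum over strategies of $\mathcal M\times\mathcal N$ of the probability, starting from $(s,q_0)$, that the run visits $S\times F$ infinitely often. $\mathcal N$ is good-for-MDPs (GFM) if for every finite MDP $\mathcal M$ and every initial state $s_0$, $\mathrm{PSyn}^{\mathcal M}_{\mathcal N}(s_0)=\mathrm{PSem}^{\mathcal M}_{\mathcal N}(s_0)$. *)

(* Defs.v *)
From HB Require Import structures.
From mathcomp Require Import all_boot all_order all_algebra.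
From mathcomp Require Import all_classical all_reals.
From mathcomp Require Import ereal measure.

Unset Printing Implicit Defensive.

Import Order.TTheory GRing.Theory Num.Theory.
Local Open Scope classical_set_scope.
Local Open Scope ring_scope.

Record NBW (Sigma : finType) := {
  nbw_state : finType;
  nbw_init  : nbw_state;
  nbw_delta : nbw_state -> Sigma -> {set nbw_state};
  nbw_final : {set nbw_state}
}.

Arguments nbw_state {Sigma} N : rename.
Arguments nbw_init {Sigma} N : rename.
Arguments nbw_delta {Sigma} N _ _ : rename.
Arguments nbw_final {Sigma} N : rename.

Definition nbw_run {Sigma : finType} (N : NBW Sigma) (w : nat -> Sigma)
    (rho : nat -> nbw_state N) : Prop :=
  rho 0%N = nbw_init N /\ forall i, rho i.+1 \in nbw_delta N (rho i) (w i).

Definition inf_often {T : Type} (P : T -> bool) (rho : nat -> T) : Prop :=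
  forall n, exists2 m, (n <= m)%N & P (rho m).

Definition nbw_lang {Sigma : finType} (N : NBW Sigma) : set (nat -> Sigma) :=
  [set w | exists rho, nbw_run N w rho /\ inf_often (mem (nbw_final N)) rho].

(* The partial transition function P : S x Act -> Dist(S) is given by the
   availability predicate [mdp_avail] (domain of P) together with
   [mdp_trans s m] (the distribution P(s,m), meaningful when available). *)
Record MDP (R : realType) (Sigma : finType) := {
  mdp_st    : finType;
  mdp_act   : finType;
  mdp_avail : mdp_st -> mdp_act -> bool;
  mdp_trans : mdp_st -> mdp_act -> mdp_st -> R;
  mdp_lab   : mdp_st -> Sigma
}.

Arguments mdp_st {R Sigma} M : rename.
Arguments mdp_act {R Sigma} M : rename.
Arguments mdp_avail {R Sigma} M _ _ : rename.
Arguments mdp_trans {R Sigma} M _ _ _ : rename.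
Arguments mdp_lab {R Sigma} M _ : rename.

Definition mdp_wf {R : realType} {Sigma : finType} (M : MDP R Sigma) : Prop :=
  forall s m, mdp_avail M s m ->
    (forall s', 0 <= mdp_trans M s m s') /\ \sum_s' mdp_trans M s m s' = 1.

Definition is_MC {R : realType} {Sigma : finType} (M : MDP R Sigma) : Prop :=
  forall s, #|[pred m | mdp_avail M s m]| = 1%N.

(* Finite run prefixes s0 m1 s1 m2 ... s_n are encoded as the history
   [:: (s0,m1); ...; (s_{n-1},m_n)] together with the last state s_n. *)
Definition history {R : realType} {Sigma : finType} (M : MDP R Sigma) :=
  seq (mdp_st M * mdp_act M).

Definition strategy {R : realType} {Sigma : finType} (M : MDP R Sigma) :=
  history M -> mdp_st M -> mdp_act M -> R.

Definition strategy_wf {R : realType} {Sigma : finType} {M : MDP R Sigma}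
    (mu : strategy M) : Prop :=
  (forall h s m, 0 <= mu h s m) /\
  (forall h s m, ~~ mdp_avail M s m -> mu h s m = 0) /\
  (forall h s, (exists m, mdp_avail M s m) -> \sum_m mu h s m = 1).

(* Infinite runs s0 m1 s1 m2 ... are encoded as w with w i = Some (s_i, m_{i+1}).
   (The [option] only serves to make the sample space a pointed type, as
   required by MathComp-Analysis; the induced measures give it no mass.) *)
Definition pathT {R : realType} {Sigma : finType} (M : MDP R Sigma) :=
  nat -> option (mdp_st M * mdp_act M).

Definition cyl {R : realType} {Sigma : finType} {M : MDP R Sigma}
    (h : history M) : set (pathT M) :=
  [set w | forall i, (i < size h)%N -> w i = onth h i].

Definition cylinders {R : realType} {Sigma : finType} (M : MDP R Sigma)
    : set (set (pathT M)) :=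
  [set cyl h | h in [set h : history M | h != [::]]].

Definition runSpace {R : realType} {Sigma : finType} (M : MDP R Sigma) :=
  g_sigma_algebraType (cylinders M).

Fixpoint cyl_prob_rec {R : realType} {Sigma : finType} {M : MDP R Sigma}
    (mu : strategy M) (past : history M) (cur : mdp_st M * mdp_act M)
    (rest : history M) : R :=
  mu past cur.1 cur.2 *
  match rest with
  | [::] => 1
  | nxt :: rest' =>
      mdp_trans M cur.1 cur.2 nxt.1 * cyl_prob_rec mu (rcons past cur) nxt rest'
  end.

Definition cyl_prob {R : realType} {Sigma : finType} {M : MDP R Sigma}
    (mu : strategy M) (s0 : mdp_st M) (h : history M) : R :=
  match h with
  | [::] => 1
  | x :: rest => (x.1 == s0)%:R * cyl_prob_rec mu [::] x rest
  end.

(* P is the probability measure Pr^mu_{s0} on infinite runs induced by the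
   strategy mu from s0: it is the (unique) measure on the cylinder
   sigma-algebra giving each cylinder its product probability (and no mass
   to the dummy point-filler runs). *)
Definition induced_measure {R : realType} {Sigma : finType} {M : MDP R Sigma}
    (mu : strategy M) (s0 : mdp_st M)
    (P : {measure set (runSpace M) -> \bar R}) : Prop :=
  (forall h : history M, h != [::] -> P (cyl h) = (cyl_prob mu s0 h)%:E) /\
  P [set w : runSpace M | w 0%N = None] = 0%E.

Definition run_states {R : realType} {Sigma : finType} {M : MDP R Sigma}
    (w : pathT M) (r : nat -> mdp_st M * mdp_act M) : Prop :=
  forall n, w n = Some (r n).

Definition sem_event {R : realType} {Sigma : finType} (M : MDP R Sigma)
    (N : NBW Sigma) : set (runSpace M) :=
  [set w | exists r, run_states w r /\
                     nbw_lang N (fun n => mdp_lab M (r n).1)].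

Definition max_prob {R : realType} {Sigma : finType} {M : MDP R Sigma}
    (E : set (runSpace M)) (s : mdp_st M) : \bar R :=
  ereal_sup [set P E | P in
    [set P : {measure set (runSpace M) -> \bar R} |
       exists mu : strategy M, strategy_wf mu /\ induced_measure mu s P]].

Definition PSem {R : realType} {Sigma : finType} (M : MDP R Sigma)
    (N : NBW Sigma) (s : mdp_st M) : \bar R :=
  max_prob (sem_event M N) s.

Definition prod_MDP {R : realType} {Sigma : finType} (M : MDP R Sigma)
    (N : NBW Sigma) : MDP R Sigma := {|
  mdp_st    := (mdp_st M * nbw_state N)%type;
  mdp_act   := (mdp_act M * nbw_state N)%type;
  mdp_avail := fun sq mq =>
     mdp_avail M sq.1 mq.1 && (mq.2 \in nbw_delta N sq.2 (mdp_lab M sq.1));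
  mdp_trans := fun sq mq sq' =>
     if sq'.2 == mq.2 then mdp_trans M sq.1 mq.1 sq'.1 else 0;
  mdp_lab   := fun sq => mdp_lab M sq.1 |}.

Definition syn_event {R : realType} {Sigma : finType} (M : MDP R Sigma)
    (N : NBW Sigma) : set (runSpace (prod_MDP M N)) :=
  [set w | exists r : nat -> mdp_st (prod_MDP M N) * mdp_act (prod_MDP M N),
     run_states w r /\
     inf_often (fun x : mdp_st (prod_MDP M N) * mdp_act (prod_MDP M N) =>
                  x.1.2 \in nbw_final N) r].

Definition PSyn {R : realType} {Sigma : finType} (M : MDP R Sigma)
    (N : NBW Sigma) (s : mdp_st M) : \bar R :=
  @max_prob R Sigma (prod_MDP M N) (syn_event M N) (s, nbw_init N).

Definition GFM (R : realType) {Sigma : finType} (N : NBW Sigma) : Prop :=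
  forall M : MDP R Sigma, mdp_wf M ->
    forall s0 : mdp_st M, PSyn M N s0 = PSem M N s0.

(* Main.v *)
(* Only PSem <= PSyn needs the hypothesis on Markov chains; PSyn <= PSem holds
   because a strategy of the product, with the automaton component forgotten,
   induces a strategy of the MDP through conditional probabilities.

   A word is accepted iff, for every large enough time j, some state reachable
   at time j starts a breakpoint construction with infinitely many breakpoints.
   For fixed j this is a deterministic Büchi condition, so the measure of the
   language is approximated, for any given strategy, by that of a deterministic
   Büchi condition with finite memory. On a finite MDP there is a region X in
   which a memoryless choice meets such a condition almost surely, while outside
   X a bounded potential decreases at every visit to the Büchi set, so that the
   condition almost surely fails on runs avoiding X. Hence the value is
   approximated by reaching X within n steps and then following the memoryless
   choice: a finite-memory strategy, i.e. a finite Markov chain C. By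
   hypothesis C x N has nearly optimal strategies, and forgetting the memory
   turns them into strategies of M x N. Dead ends of M become self-loops of C;
   they do no harm, as on the stuck runs, too, the syntactic probability is at
   most the semantic one. *)

Require Import Defs.
From mathcomp Require Import all_boot all_order all_algebra.
From mathcomp Require Import all_classical all_reals.
From mathcomp Require Import ereal measure sequences topology normedtype.
From mathcomp Require Import lebesgue_measure.
From mathcomp Require Import zify lra.

Set Implicit Arguments.
Unset Strict Implicit.
Import Order.TTheory GRing.Theory Num.Theory.
Local Open Scope classical_set_scope.
Local Open Scope ring_scope.

(** * Measures on runs *)

(** At a dead end a strategy has nothing to distribute, so an induced measure may have total mass
    below 1 and cylinder weights are only sub-additive. Two MDPs are therefore compared by
    inequalities, and only on infinite runs, where both objectives live. Values are suprema over
    measures that exist, so each strategy that is built also needs a measure constructed for it.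

    Soundness of the breakpoint condition holds for each single [j]; completeness for all large [j]
    is what makes the approximating sets increase, so that continuity of measure applies.

    The almost-sure statements about strategies come from potentials with values in [0,1]: a drop by
    a fixed [d] in expectation at each visit makes the visit probabilities summable, and
    Borel-Cantelli applies. No theory of end components enters: the region and its potentials are
    built round by round, with constants that shrink with the least positive transition
    probability. *)

Section Words.
Variable X : finType.

Fixpoint words n : seq (seq X) :=
  if n is n'.+1 then [seq rcons h x | h <- words n', x <- enum X] else [:: [::]].

Lemma mem_words n (h : seq X) : (h \in words n) = (size h == n).
Proof.
elim: n h => [|n IH] h; first by rewrite inE; case: h.
apply/allpairsP/eqP => [[[k x]/= [kn _ ->]]|].
  by rewrite size_rcons; move: kn; rewrite IH => /eqP ->.
case/lastP: h => [//|h x]; rewrite size_rcons => -[hn].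
by exists (h, x) => /=; rewrite IH hn mem_enum.
Qed.

Lemma words_uniq n : uniq (words n).
Proof.
elim: n => //= n IH; apply: allpairs_uniq => //; first exact: enum_uniq.
by move=> [h x] [k y] _ _ /= /rcons_inj [-> ->].
Qed.

Lemma sum_wordsS (R : nmodType) n (F : seq X -> R) :
  \sum_(h <- words n.+1) F h = \sum_(h <- words n) \sum_x F (rcons h x).
Proof. by rewrite /= big_allpairs_dep; apply: eq_bigr => h _; rewrite big_enum. Qed.

End Words.

Lemma onth_rcons_lt (T : Type) (h : seq T) x i :
  (i < size h)%N -> onth (rcons h x) i = onth h i.
Proof. by elim: h i => [|y h IH] [|i] //= ih; exact: IH. Qed.

Lemma onth_rcons_size (T : Type) (h : seq T) x : onth (rcons h x) (size h) = Some x.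
Proof. by elim: h. Qed.

(** * Coding words by nested intervals of the real line *)

Section NestedIntervals.
Variables (R : realType) (X : finType) (c : seq X -> R).
Hypothesis c_ge0 : forall h, 0 <= c h.
Hypothesis c_sub : forall h, \sum_x c (rcons h x) <= c h.

(** The interval of [h], of length [c h], is cut from left to right, in the order of [enum_rank],
    into the intervals of its one-letter extensions; this is the offset of the one for [x].
    Sub-additivity may leave a gap at the right end. *)
Definition wordsBefore (h : seq X) (x : X) : R :=
  \sum_(y : X | (enum_rank y < enum_rank x)%N) c (rcons h y).

Fixpoint leftEnd_from (past h : seq X) : R :=
  if h is x :: h' then wordsBefore past x + leftEnd_from (rcons past x) h' else 0.

Definition leftEnd := leftEnd_from [::].

Lemma leftEnd_rcons h x : leftEnd (rcons h x) = leftEnd h + wordsBefore h x.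
Proof.
rewrite /leftEnd -{3}[h]cat0s; elim: h [::] => [|y h IH] past /=.
  by rewrite cats0 addr0 add0r.
by rewrite IH addrA cat_rcons.
Qed.

Definition inInterval (u : R) h := leftEnd h <= u < leftEnd h + c h.

Lemma wordsBefore_ge0 h x : 0 <= wordsBefore h x.
Proof. exact: sumr_ge0. Qed.

Lemma wordsBefore_le h x : wordsBefore h x + c (rcons h x) <= c h.
Proof.
apply: le_trans (c_sub h); rewrite /wordsBefore [leRHS](bigD1 x)//= [leRHS]addrC lerD2r.
rewrite big_mkcond [leRHS]big_mkcond; apply: ler_sum => y _.
by case: (eqVneq y x) => [->|_]; rewrite ?ltnn//=; case: ifP.
Qed.

Lemma wordsBefore_lt h x y : (enum_rank x < enum_rank y)%N ->
  wordsBefore h x + c (rcons h x) <= wordsBefore h y.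
Proof.
move=> xy; rewrite /wordsBefore [leRHS](bigD1 x)//= [leRHS]addrC lerD2r.
rewrite big_mkcond [leRHS]big_mkcond; apply: ler_sum => z _.
case: (eqVneq z x) => [->|_]; rewrite ?ltnn ?andbF//= andbT.
by case: ifP => [zx|_]; [rewrite (ltn_trans zx xy)|case: ifP].
Qed.

Lemma inInterval_rcons u h x : inInterval u (rcons h x) -> inInterval u h.
Proof.
rewrite /inInterval leftEnd_rcons => /andP[l r].
have := wordsBefore_ge0 h x; have := wordsBefore_le h x => *.
by apply/andP; split; lra.
Qed.

Lemma inInterval_inj u h x y :
  inInterval u (rcons h x) -> inInterval u (rcons h y) -> x = y.
Proof.
rewrite /inInterval !leftEnd_rcons => /andP[l r] /andP[l' r'].
apply/enum_rank_inj/val_inj/eqP; case: ltngtP => // xy.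
  by have := wordsBefore_lt h xy; lra.
by have := wordsBefore_lt h xy; lra.
Qed.

Lemma inInterval_uniq u h k : size h = size k ->
  inInterval u h -> inInterval u k -> h = k.
Proof.
elim/last_ind: h k => [|h x IH] k; first by case: k.
case/lastP: k => [|k y]; rewrite !size_rcons// => -[hk] uh uk.
have hk' := IH k hk (inInterval_rcons uh) (inInterval_rcons uk).
by rewrite -hk' in uk *; rewrite (inInterval_inj uh uk).
Qed.

(** Each depth is read off separately, without recursion: intervals of equally long words are
    disjoint, so the letters found at different depths fit together. [None] means that [u] lies in
    no interval of depth [n.+1]. *)
Definition sample (u : R) (n : nat) : option X :=
  [pick x | `[< exists2 h, size h = n & inInterval u (rcons h x) >]].

Lemma sampleP u h x : inInterval u (rcons h x) -> sample u (size h) = Some x.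
Proof.
move=> uhx; rewrite /sample; case: pickP => [y /asboolP[k kh uk]|/(_ x)/asboolP[]].
  have /rcons_inj[_ ->//] : rcons k y = rcons h x.
  by apply: inInterval_uniq uk uhx; rewrite !size_rcons kh.
by exists h.
Qed.

(** Preimages of cylinders become half-open intervals, which yields both the measurability of
    sampling and the mass of each cylinder. The empty word is excluded because its cylinder also
    contains the samples of points outside its interval. *)
Lemma sample_cyl u h : h != [::] ->
  (forall i, (i < size h)%N -> sample u i = onth h i) <-> inInterval u h.
Proof.
elim/last_ind: h => [//|h x IH] _; split=> [hu|uhx i].
  have /= := hu (size h); rewrite size_rcons leqnn onth_rcons_size => /(_ erefl).
  rewrite /sample; case: pickP => // y /asboolP[k kh uk] [yx].
  suff -> : h = k by rewrite -yx.
  case: (eqVneq h [::]) => [h0|h0]; first by move: kh; rewrite h0 => /size0nil.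
  apply: (@inInterval_uniq u) => //; last exact: inInterval_rcons uk.
  apply/IH => // i ih; rewrite hu ?size_rcons 1?ltnW//.
  by rewrite onth_rcons_lt.
rewrite size_rcons ltnS leq_eqVlt => /predU1P[->|ih].
  by rewrite onth_rcons_size; exact: sampleP.
have h0 : h != [::] by apply: contraTneq ih => ->.
by rewrite onth_rcons_lt//; apply: (IH h0).2 => //; exact: inInterval_rcons uhx.
Qed.

End NestedIntervals.

(** * Cylinder events and measures with prescribed cylinder weights *)

Section RunSpace.
Variables (R : realType) (Sigma : finType) (M : MDP R Sigma).
Local Notation X := (mdp_st M * mdp_act M)%type.
Local Notation measureM := {measure set (runSpace M) -> \bar R}.
Implicit Types (h : history M) (phi : pred (history M)) (P : measureM).

(** The first [n] letters must exist, so even [ev n predT] omits the runs with a [None] among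
    them. *)
Definition ev n phi : set (runSpace M) :=
  [set w | exists2 h : history M, size h = n & cyl h w /\ phi h].

Definition infinite_runs : set (runSpace M) := \bigcap_n ev n predT.

Lemma measurable_cyl h : measurable (cyl h : set (runSpace M)).
Proof.
case: (eqVneq h [::]) => [->|h0]; last by apply: sub_sigma_algebra; exists h.
by rewrite (_ : cyl _ = setT)//; apply/seteqP; split.
Qed.

Lemma evE n phi : ev n phi = \bigcup_(h in [set` [seq h <- words _ n | phi h]]) cyl h.
Proof.
apply/seteqP; split => w /=.
  by move=> [h hn [hw ph]]; exists h => //=; rewrite mem_filter ph mem_words hn eqxx.
by move=> [h /=]; rewrite mem_filter mem_words => /andP[ph /eqP hn] hw; exists h.
Qed.

Lemma measurable_ev n phi : measurable (ev n phi).
Proof.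
by rewrite evE; apply: fin_bigcup_measurable => // h _; exact: measurable_cyl.
Qed.

Lemma measurable_buchi (phi : nat -> pred (history M)) :
  measurable (lim_sup_set (fun n => ev n (phi n))).
Proof.
apply: bigcapT_measurable => n; apply: bigcup_measurable => m _.
exact: measurable_ev.
Qed.

Lemma measurable_infinite_runs : measurable infinite_runs.
Proof. by apply: bigcapT_measurable => n; exact: measurable_ev. Qed.

Lemma cyl_uniq h k (w : runSpace M) : size h = size k -> cyl h w -> cyl k w -> h = k.
Proof.
move=> hk hw kw; apply: eq_from_onth => i.
case: (ltnP i (size h)) => ih; first by rewrite -hw// -kw -?hk.
by rewrite !onth_default// -hk.
Qed.

Lemma cyl_rcons h x (w : runSpace M) :
  cyl (rcons h x) w <-> cyl h w /\ w (size h) = Some x.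
Proof.
split=> [hw|[hw wx] i]; last first.
  rewrite size_rcons ltnS leq_eqVlt => /predU1P[->|ih]; first by rewrite onth_rcons_size.
  by rewrite onth_rcons_lt// hw.
split=> [i ih|]; first by rewrite hw ?onth_rcons_lt// size_rcons ltnW.
by rewrite hw ?onth_rcons_size// size_rcons.
Qed.

Lemma infinite_runsP (w : runSpace M) :
  infinite_runs w <-> exists r, run_states w r.
Proof.
split=> [winf|[r wr] n _].
  have nN n : w n != None.
    have [h hn [hw _]] := winf n.+1 I.
    by rewrite hw ?hn//; have := onthTE h n; rewrite hn ltnSn; case: onth.
  have [x wx] : exists x, w 0%N = Some x by case: (w 0%N) (nN 0%N) => [x|]//; exists x.
  exists (fun n => odflt x (w n)) => n.
  by case: (w n) (nN n).
exists (mkseq r n); first by rewrite size_mkseq.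
split=> // i; rewrite size_mkseq => ilt; rewrite wr.
by rewrite onthE -map_comp (nth_map 0%N) ?size_iota// nth_iota.
Qed.

Definition has_weight P (c : history M -> R) :=
  forall h, h != [::] -> P (cyl h) = (c h)%:E.

Lemma measure_ev P c n phi : has_weight P c -> (0 < n)%N ->
  P (ev n phi) = (\sum_(h <- words _ n | phi h) c h)%:E.
Proof.
move=> Pc n0; rewrite evE measure_fin_bigcup; last 3 first.
- exact: finite_seq.
- apply/trivIsetP => h k /=; rewrite !mem_filter !mem_words.
  move=> /andP[_ /eqP hn] /andP[_ /eqP kn] hk.
  rewrite -subset0 => w [hw kw]; case/eqP: hk; apply: cyl_uniq hw kw.
  by rewrite hn kn.
- by move=> h _; exact: measurable_cyl.
rewrite -fsbig_seq ?filter_uniq ?words_uniq// big_filter -sumEFin.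
rewrite [LHS]big_seq_cond [RHS]big_seq_cond; apply: eq_bigr => h.
rewrite mem_words => /andP[/eqP hn _]; apply: Pc.
by apply: contraTneq n0 => h0; rewrite -hn h0.
Qed.

Lemma measure_setT P c : has_weight P c -> P [set w | w 0%N = None] = 0%E ->
  P setT = (\sum_x c [:: x])%:E.
Proof.
move=> Pc P0.
have -> : [set: runSpace M] = ev 1 predT `|` [set w | w 0%N = None].
  apply/seteqP; split => // w _; case E: (w 0%N) => [x|]; [left|by right].
  by exists [:: x] => //; split=> // -[].
have N1 : [set w : runSpace M | w 0%N = None] = ~` ev 1 predT.
  apply/seteqP; split => w /=.
    by move=> w0 [[|x []]]//= _ [/(_ 0%N erefl)]; rewrite w0.
  case E: (w 0%N) => [x|]// []; exists [:: x] => //; split=> // -[]//.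
rewrite measureU; last 3 first.
- exact: measurable_ev.
- by rewrite N1; apply: measurableC; exact: measurable_ev.
- by rewrite N1 setICr.
rewrite [X in (_ + X)%E = _]P0 adde0.
apply: etrans (measure_ev predT Pc (ltn0Sn 0)) _.
by rewrite sum_wordsS/= big_seq1.
Qed.

(* Reading off the nested intervals, of lengths given by [c], that contain a
   point of the real line pushes Lebesgue measure forward to the runs. *)
Lemma measure_of_weight (c : history M -> R) :
  (forall h, 0 <= c h) -> (forall h, h != [::] -> \sum_x c (rcons h x) <= c h) ->
  exists P, has_weight P c /\ P [set w | w 0%N = None] = 0%E.
Proof.
move=> c0 cS.
(* The weight of the empty word is replaced by the sum over the first letters. This closes the gap
   at depth one, so that no sampled run begins with [None]. *)
pose d h := if h == [::] then \sum_x c [:: x] else c h.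
have dn h : h != [::] -> d h = c h by rewrite /d => /negbTE ->.
have rN (h : history M) x : rcons h x != [::] by case: h.
have d0 h : 0 <= d h by rewrite /d; case: ifP => // _; exact: sumr_ge0.
have dS h : \sum_x d (rcons h x) <= d h.
  have -> : \sum_x d (rcons h x) = \sum_x c (rcons h x).
    by apply: eq_bigr => x _; rewrite dn.
  by rewrite /d; case: eqP => [->|/eqP/cS].
pose f (u : measurableTypeR R) : runSpace M := sample d u.
have fcyl h : h != [::] -> f @^-1` cyl h = [set` `[leftEnd d h, leftEnd d h + d h[].
  move=> h0; apply/seteqP; split => u /=; rewrite in_itv/=.
    by move=> /(sample_cyl d0 dS u h0).
  by move=> /(sample_cyl d0 dS u h0).
have mf : measurable_fun setT f.
  apply: (@measurability _ _ _ (runSpace M) setT f (cylinders M) erefl) => _ [_ [h h0 <-] <-].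
  by rewrite setTI fcyl.
have mD : measurable ([set` `[0, d [::][] : set (measurableTypeR R)).
  exact: measurable_itv.
pose mu : {measure set (measurableTypeR R) -> \bar R} := mrestr lebesgue_measure mD.
have [nu nuE] : exists nu : measureM, forall A, nu A = mu (f @^-1` A).
  by unshelve eexists (pushforward mu f).
exists nu.
have sub0 u h : inInterval d u h -> inInterval d u [::].
  by elim/last_ind: h => // h x IH /inInterval_rcons-/(_ d0 dS)/IH.
split=> [h h0|].
  rewrite nuE fcyl// /mu/= /mrestr setIidl; last first.
    move=> u; rewrite /= !in_itv/= => uh; have := sub0 u h uh.
    by rewrite /inInterval /leftEnd/= add0r.
  rewrite lebesgue_measure_itv/= lte_fin; case: ifPn => [_|].
    by rewrite -EFinD addrC addKr dn.
  by rewrite -dn// ltrDl -leNgt => dle; have -> : d h = 0 by apply/eqP; rewrite eq_le dle d0.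
rewrite nuE /mu/= /mrestr.
rewrite (_ : _ `&` _ = set0) ?measure0//; rewrite -subset0 => u [/=].
rewrite in_itv/= => + /andP[u0 ud]; rewrite /f /sample.
case: pickP => // uN _.
suff [x ux] : exists x, inInterval d u [:: x].
  by have /asboolP[] := uN x; exists [::].
apply: contrapT => nex.
(* A point in none of the first-letter intervals is pushed to the right past one after the other,
   and so leaves the interval of the empty word. *)
have H k : (k <= #|{: X}|)%N -> \sum_(y : X | (enum_rank y < k)%N) d [:: y] <= u.
  elim: k => [|k IH] kX; first by rewrite big_pred0.
  have kx := IH (ltnW kX); pose x := enum_val (Ordinal kX).
  have rx : enum_rank x = k :> nat by rewrite enum_valK.
  rewrite (bigD1 x)/= ?rx// (eq_bigl (fun y : X => (enum_rank y < k)%N)); last first.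
    move=> y; rewrite ltnS [RHS]ltn_neqAle andbC; congr (~~ _ && _).
    apply/eqP/eqP => [->//|ey]; apply/enum_rank_inj/val_inj.
    by rewrite /= ey -rx.
  rewrite leNgt addrC; apply/negP => ux; apply: nex; exists x.
  by rewrite /inInterval /leftEnd/= addr0 /wordsBefore rx kx.
have := H _ (leqnn _); rewrite (eq_bigl predT) => [|y]; last by rewrite ltn_ord.
have -> : \sum_y d [:: y] = d [::] by rewrite /d eqxx; apply: eq_bigr.
by rewrite leNgt ud.
Qed.

End RunSpace.

Arguments infinite_runs {R Sigma} M _ : rename.

(** * The measure induced by a strategy *)

Section InducedMeasure.
Variables (R : realType) (Sigma : finType) (M : MDP R Sigma).
Variables (mu : strategy M) (s0 : mdp_st M).
Local Notation X := (mdp_st M * mdp_act M)%type.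
Local Notation measureM := {measure set (runSpace M) -> \bar R}.
Local Notation c := (cyl_prob mu s0).
Hypotheses (Mwf : mdp_wf M) (muwf : strategy_wf mu).
Implicit Types (h : history M) (x y : X).

Lemma cyl_prob_rcons h x y :
  c (rcons (rcons h x) y) =
  c (rcons h x) * (mdp_trans M x.1 x.2 y.1 * mu (rcons h x) y.1 y.2).
Proof.
have rec past cur rest : cyl_prob_rec mu past cur (rcons rest y) =
    cyl_prob_rec mu past cur rest *
    (mdp_trans M (last cur rest).1 (last cur rest).2 y.1 *
     mu (rcons past cur ++ rest) y.1 y.2).
  elim: rest past cur => [|z rest IH] past cur /=; first by rewrite !mulr1 cats0 mulrA.
  by rewrite IH cat_rcons !mulrA.
case: h => [|z h] /=; first by rewrite !mulr1 !mulrA.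
by rewrite rec last_rcons !mulrA.
Qed.

Lemma cyl_prob1 x : c [:: x] = (x.1 == s0)%:R * mu [::] x.1 x.2.
Proof. by rewrite /= mulr1. Qed.

Lemma cyl_prob_factor h x : exists p, c (rcons h x) = p * mu h x.1 x.2.
Proof.
case/lastP: h => [|h y]; first by eexists; exact: cyl_prob1.
by rewrite cyl_prob_rcons mulrA; eexists.
Qed.

Lemma cyl_prob_unavailable h x : ~~ mdp_avail M x.1 x.2 -> c (rcons h x) = 0.
Proof.
by have [p ->] := cyl_prob_factor h x; move=> /(muwf.2.1 h) ->; rewrite mulr0.
Qed.

Lemma cyl_prob_ge0 h : 0 <= c h.
Proof.
elim/last_ind: h => // h y; case/lastP: h => [_|h x IH].
  by rewrite cyl_prob1 mulr_ge0// muwf.1.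
rewrite cyl_prob_rcons; have [xa|xa] := boolP (mdp_avail M x.1 x.2).
  by rewrite !mulr_ge0// ?muwf.1//; exact: (Mwf xa).1.
by rewrite cyl_prob_unavailable// mul0r.
Qed.

(** The sum is 1 except at dead ends, where it is 0; this is the source of all later inequalities
    between weights. *)
Lemma strategy_sum_le1 h s : \sum_m mu h s m <= 1.
Proof.
have [_ [mu0 mu1]] := muwf.
case: (pselect (exists m, mdp_avail M s m)) => [/mu1->//|nex].
by rewrite big1// => m _; apply: mu0; apply/negP => sm; apply: nex; exists m.
Qed.

Lemma sum_letters (F : X -> R) : \sum_x F x = \sum_s \sum_m F (s, m).
Proof. by rewrite pair_big; apply: eq_bigr => -[]. Qed.

Lemma cyl_prob_step h x s : \sum_m c (rcons (rcons h x) (s, m)) <=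
  c (rcons h x) * mdp_trans M x.1 x.2 s.
Proof.
under eq_bigr do rewrite cyl_prob_rcons mulrA /=.
rewrite -mulr_sumr -[leRHS]mulr1.
have [xa|xa] := boolP (mdp_avail M x.1 x.2).
  apply: ler_wpM2l; last exact: strategy_sum_le1.
  by rewrite mulr_ge0 ?cyl_prob_ge0//; exact: (Mwf xa).1.
by rewrite cyl_prob_unavailable// !mul0r.
Qed.

Lemma cyl_prob_sub h : h != [::] -> \sum_x c (rcons h x) <= c h.
Proof.
case/lastP: h => // h x _; rewrite sum_letters.
apply: le_trans (ler_sum _ (fun s _ => cyl_prob_step h x s)) _.
rewrite -mulr_sumr; have [xa|xa] := boolP (mdp_avail M x.1 x.2).
  by rewrite (Mwf xa).2 mulr1.
by rewrite cyl_prob_unavailable// mul0r.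
Qed.

Lemma cyl_prob_init (F : mdp_st M -> R) : 0 <= F s0 ->
  \sum_x c [:: x] * F x.1 <= F s0.
Proof.
move=> F0; rewrite sum_letters (bigD1 s0)//= [X in _ + X]big1 => [|s ss0]; last first.
  by rewrite (negbTE ss0) big1// => m _; rewrite !mul0r.
rewrite eqxx addr0 -mulr_suml; under eq_bigr do rewrite mul1r mulr1.
by rewrite ler_piMl// strategy_sum_le1.
Qed.

Lemma cyl_prob_total : \sum_x c [:: x] <= 1.
Proof. by have := cyl_prob_init (F := cst 1) ler01; under eq_bigr do rewrite mulr1. Qed.

Lemma exists_induced : exists P : measureM, induced_measure mu s0 P.
Proof. exact: measure_of_weight cyl_prob_ge0 cyl_prob_sub. Qed.

Lemma induced_le1 (P : measureM) : induced_measure mu s0 P -> (P setT <= 1)%E.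
Proof.
by case=> Pc P0; rewrite (measure_setT Pc P0) lee_fin; exact: cyl_prob_total.
Qed.

End InducedMeasure.

(** * Comparing measures on infinite runs through their cylinders *)

Section Domination.
Variables (R : realType) (Sigma : finType) (M : MDP R Sigma).
Local Notation X := (mdp_st M * mdp_act M)%type.
Local Notation measureM := {measure set (runSpace M) -> \bar R}.
Implicit Types (h k : history M) (x y : X).

Lemma fin_num_finite_measure (P : measureM) (A : set (runSpace M)) :
  (P setT < +oo)%E -> measurable A -> P A \is a fin_num.
Proof.
move=> Pfin mA; rewrite ge0_fin_numE ?measure_ge0//.
by apply: le_lt_trans Pfin; apply: le_measure; rewrite ?inE.
Qed.

Lemma cylI_evE k m : (size k <= m)%N ->
  cyl k `&` ev m predT = ev m (fun h => take (size k) h == k) :> set (runSpace M).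
Proof.
move=> km; apply/seteqP; split => w.
  move=> [kw [h hm [hw _]]]; exists h => //; split=> //; apply/eqP.
  apply: (@cyl_uniq _ _ _ _ _ w) => //; first by rewrite size_takel ?hm.
  move=> i; rewrite size_takel ?hm// => ik; rewrite hw ?hm ?(leq_trans ik)//.
  by rewrite -{1}(cat_take_drop (size k) h) onth_cat size_takel ?hm// ik.
move=> [h hm [hw /eqP hk]]; split; last by exists h.
move=> i ik; rewrite hw ?hm ?(leq_trans ik)//.
by rewrite -{1}(cat_take_drop (size k) h) onth_cat hk ik.
Qed.

Lemma cyl_infinite_runsE k : cyl k `&` infinite_runs M =
  \bigcup_(x in [set: X]) (cyl (rcons k x) `&` infinite_runs M).
Proof.
apply/seteqP; split => w /=; last by move=> [x _ [/cyl_rcons[kw _] iw]].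
move=> [kw iw]; have /infinite_runsP[r wr] := iw.
by exists (r (size k)) => //; split=> //; apply/cyl_rcons.
Qed.

Lemma measure_cyl_infinite_runs (Q : measureM) k :
  Q (cyl k `&` infinite_runs M) = (\sum_x Q (cyl (rcons k x) `&` infinite_runs M))%E.
Proof.
rewrite cyl_infinite_runsE measure_fin_bigcup//.
- rewrite -big_enum/= [RHS]fsbig_seq ?enum_uniq//=.
  suff -> : [set` enum {: X}] = [set: X] by [].
  by apply/seteqP; split => // x _; rewrite /= mem_enum.
- exact: finite_finset.
- apply/trivIsetP => x y _ _ /eqP xy; rewrite -subset0 => w.
  move=> [[/cyl_rcons[_ wx] _] [/cyl_rcons[_ wy] _]]; apply: xy.
  by move: wx; rewrite wy => -[].
- by move=> x _; apply: measurableI;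
    [exact: measurable_cyl|exact: measurable_infinite_runs].
Qed.

(* The excess of [Q2] over [Q1] on the infinite runs of each cylinder is again an
   additive weight; the measure it defines accounts for [Q2 - Q1]. Finite runs
   have to be excluded: where [Q2] continues, [Q1] may already have stopped. *)
Lemma measure_cyl_dom (Q1 Q2 : measureM) (E : set (runSpace M)) :
  (Q1 setT < +oo)%E -> (Q2 setT < +oo)%E ->
  (forall k, k != [::] -> (Q1 (cyl k) <= Q2 (cyl k))%E) ->
  measurable E -> E `<=` infinite_runs M -> (Q1 E <= Q2 E)%E.
Proof.
move=> f1 f2 Q12 mE Einf.
have mI := @measurable_infinite_runs _ _ M.
have mcI k : measurable ((cyl k : set (runSpace M)) `&` infinite_runs M).
  by apply: measurableI => //; exact: measurable_cyl.
have fin (Q : measureM) A : (Q setT < +oo)%E -> measurable A -> (fine (Q A))%:E = Q A.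
  by move=> Qf mA; rewrite fineK// fin_num_finite_measure.
have w (Q : measureM) : (Q setT < +oo)%E -> has_weight Q (fun h => fine (Q (cyl h))).
  by move=> Qf h _; rewrite fin//; exact: measurable_cyl.
have ev12 m phi : (0 < m)%N -> (Q1 (ev m phi) <= Q2 (ev m phi))%E.
  move=> m0; rewrite (measure_ev _ (w _ f1))// (measure_ev _ (w _ f2))// lee_fin.
  rewrite big_seq_cond [leRHS]big_seq_cond; apply: ler_sum => h.
  rewrite mem_words => /andP[/eqP hm _]; rewrite -lee_fin.
  rewrite !fin//; try exact: measurable_cyl.
  by apply: Q12; apply: contraTneq m0 => h0; rewrite -hm h0.
have cI12 k : (Q1 (cyl k `&` infinite_runs M) <= Q2 (cyl k `&` infinite_runs M))%E.
  (* The infinite runs in [cyl k] are a decreasing intersection of finite unions of cylinders, on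
     which the hypothesis can be summed. The lengths are positive and exceed that of [k], so these
     unions are of nonempty cylinders extending [k]. *)
  pose F m := cyl k `&` ev (m + size k).+1 predT : set (runSpace M).
  have FE : cyl k `&` infinite_runs M = \bigcap_m F m.
    apply/seteqP; split=> [v [kv iv] m _|v Fv]; first by split=> //; exact: iv.
    split=> [|m _]; first exact: (Fv 0%N I).1.
    have [_ [h hm [hv _]]] := Fv m I; exists (take m h).
      by rewrite size_takel// hm ltnW// ltnS leq_addr.
    split=> // i; rewrite size_takel ?hm ?(leq_trans (leq_addr (size k) m))// => im.
    rewrite hv ?hm ?(leq_trans im) ?(leq_trans (leq_addr (size k) m))//.
    rewrite -{1}(cat_take_drop m h) onth_cat size_takel ?im//.
    by rewrite hm (leq_trans (leq_addr (size k) m)).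
  have mF m : measurable (F m).
    by apply: measurableI; [exact: measurable_cyl|exact: measurable_ev].
  have F_dec : {homo F : n m / (n <= m)%N >-> (m <= n)%O}.
    move=> n m nm; apply/subsetPset => v [kv [h hm [hv _]]]; split=> //.
    have nm' : ((n + size k).+1 <= size h)%N by rewrite hm ltnS leq_add2r.
    exists (take (n + size k).+1 h); first by rewrite size_takel.
    split=> // i; rewrite size_takel// => im.
    rewrite hv ?(leq_trans im)// -{1}(cat_take_drop (n + size k).+1 h) onth_cat.
    by rewrite size_takel// im.
  have cv (Q : measureM) : (Q setT < +oo)%E ->
      Q \o F @ \oo --> Q (cyl k `&` infinite_runs M).
    move=> Qf; rewrite FE; apply: nonincreasing_cvg_mu => //.
      by rewrite ltey_eq fin_num_finite_measure.
    by rewrite -FE.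
  rewrite -(cvg_lim _ (cv _ f1))// -(cvg_lim _ (cv _ f2))//.
  apply: lee_lim; [exact: cvgP (cv _ f1)|exact: cvgP (cv _ f2)|].
  by apply: nearW => m /=; rewrite /F cylI_evE ?ev12// ltnW// ltnS leq_addl.
pose d k := fine (Q2 (cyl k `&` infinite_runs M)) - fine (Q1 (cyl k `&` infinite_runs M)).
have dS k : \sum_x d (rcons k x) = d k.
  have add (Q : measureM) : (Q setT < +oo)%E -> fine (Q (cyl k `&` infinite_runs M)) =
      \sum_x fine (Q (cyl (rcons k x) `&` infinite_runs M)).
    move=> Qf; apply: EFin_inj; rewrite fin// -sumEFin measure_cyl_infinite_runs.
    by apply: eq_bigr => x _; rewrite fin.
  by rewrite sumrB /d !add.
have d0 k : 0 <= d k by rewrite subr_ge0 -lee_fin !fin.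
have dS' k : k != [::] -> \sum_x d (rcons k x) <= d k by rewrite dS.
have [Q3 [Q3d Q3N]] := measure_of_weight d0 dS'.
pose Q := measure_add (mrestr Q1 mI) Q3 : measureM.
have QE A : Q A = (Q1 (A `&` infinite_runs M) + Q3 A)%E by exact: measure_addE.
(* Two cylinders are nested or disjoint, so together with [set0] they form a generating pi-system,
   and it suffices to compare [Q] and the restriction of [Q2] on it. *)
pose G := [set A : set (runSpace M) | A = set0 \/ exists k, A = cyl k].
have mG : measurable = <<s G >>.
  apply/seteqP; split.
    by apply: sub_sigma_algebra2 => _ [h _ <-]; right; exists h.
  apply: smallest_sub; first exact: sigma_algebra_measurable.
  by move=> _ [->//|[k ->]]; exact: measurable_cyl.
have GI : setI_closed G.
  move=> _ _ [->|[h ->]] [->|[k ->]]; rewrite ?set0I ?setI0; try by left.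
  wlog hk : h k / (size h <= size k)%N.
    by move=> H; case: (leqP (size h) (size k)) => [/H//|/ltnW /H]; rewrite setIC.
  have [khE|khN] := eqVneq (take (size h) k) h; last first.
    left; rewrite -subset0 => v [hw kw]; case/eqP: khN.
    apply: (@cyl_uniq _ _ _ _ _ v) => //; first by rewrite size_takel.
    move=> i; rewrite size_takel// => ih; rewrite kw ?(leq_trans ih)//.
    by rewrite -{1}(cat_take_drop (size h) k) onth_cat size_takel ?ih.
  right; exists k; rewrite setIidr// => v kw i ih; rewrite kw ?(leq_trans ih)//.
  by rewrite -{1}(cat_take_drop (size h) k) onth_cat khE ih.
have Q3c k : Q3 (cyl k) = (d k)%:E.
  case: (eqVneq k [::]) => [->|/Q3d//]; rewrite -dS -(measure_setT Q3d Q3N).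
  by congr (Q3 _); apply/seteqP; split.
have Qeq A : measurable A -> Q A = mrestr Q2 mI A.
  apply: (@measure_unique _ _ _ G (fun=> cyl [::]) mG GI).
  - by move=> _; right; exists [::].
  - by rewrite bigcup_const//; apply/seteqP; split.
  - move=> _ [->|[k ->]]; first by rewrite !measure0.
    rewrite QE Q3c; have e1 := fin Q1 _ f1 (mcI k); have e2 := fin Q2 _ f2 (mcI k).
    rewrite -[RHS]/(Q2 (cyl k `&` infinite_runs M)).
    by rewrite -e1 -e2 -EFinD /d addrC subrK.
  - move=> _; rewrite QE Q3c; have e1 := fin Q1 _ f1 (mcI [::]).
    by rewrite -e1 -EFinD ltry.
rewrite -(setIidl Einf); have := Qeq E mE.
rewrite /mrestr QE => <-; apply: leeDl.
by rewrite measure_ge0.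
Qed.

End Domination.
(** * Simulations between MDPs *)

Section PathMap.
Variables (R : realType) (Sigma1 Sigma2 : finType).
Variables (M1 : MDP R Sigma1) (M2 : MDP R Sigma2).
Local Notation X1 := (mdp_st M1 * mdp_act M1)%type.
Local Notation X2 := (mdp_st M2 * mdp_act M2)%type.
Variable f : X1 -> option X2.

(** A letter without image becomes [None]; a run containing one is thereby sent outside the infinite
    runs. *)
Definition pathmap (w : runSpace M1) : runSpace M2 := fun n => obind f (w n).

Lemma preimage_pathmap_cyl (k : history M2) : pathmap @^-1` cyl k =
  ev (size k) (fun h => map f h == map Some k).
Proof.
apply/seteqP; split=> w /=; last first.
  move=> [h hk [hw /eqP fh]] i ik; rewrite /pathmap hw ?hk//.
  have : onth (map f h) i = onth (map Some k) i by rewrite fh.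
  by rewrite !onth_map; case: (onth h i) (onthTE h i) (onth k i) (onthTE k i)
    => [x|]; rewrite hk ik// => _ [y|]//= _ [->].
elim/last_ind: k => [|k y IH] kw; first by exists [::].
have /cyl_rcons[kw' wk] := kw.
have [h hk [hw /eqP fh]] := IH kw'; move: wk; rewrite /pathmap.
case wx : (w (size k)) => [x|]//= fx; exists (rcons h x).
  by rewrite !size_rcons hk.
by split; [apply/cyl_rcons; rewrite hk|rewrite !map_rcons fh fx].
Qed.

Lemma measurable_pathmap : measurable_fun setT pathmap.
Proof.
apply: (@measurability _ _ (runSpace M1) (runSpace M2) setT pathmap
  (cylinders M2) erefl) => _ [_ [k k0 <-] <-].
by rewrite setTI preimage_pathmap_cyl; exact: measurable_ev.
Qed.

Lemma measurable_preimage_pathmap (E : set (runSpace M2)) :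
  measurable E -> measurable (pathmap @^-1` E).
Proof. by move=> mE; rewrite -[X in measurable X]setTI; exact: measurable_pathmap. Qed.

Lemma measure_pathmap_dom (P1 : {measure set (runSpace M1) -> \bar R})
    (P2 : {measure set (runSpace M2) -> \bar R}) (E : set (runSpace M2)) :
  (P1 setT < +oo)%E -> (P2 setT < +oo)%E ->
  (forall k, k != [::] -> (P1 (pathmap @^-1` cyl k) <= P2 (cyl k))%E) ->
  measurable E -> E `<=` infinite_runs M2 -> (P1 (pathmap @^-1` E) <= P2 E)%E.
Proof.
move=> P1f P2f P12 mE Einf.
have [Q QE] : exists Q : {measure set (runSpace M2) -> \bar R},
    forall A, Q A = P1 (pathmap @^-1` A).
  by unshelve eexists (pushforward P1 pathmap); first exact: measurable_pathmap.
rewrite -QE; apply: measure_cyl_dom => //; first by rewrite QE preimage_setT.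
by move=> k k0; rewrite QE P12.
Qed.

End PathMap.

Section Simulation.
Variables (R : realType) (Sigma1 Sigma2 : finType).
Variables (M1 : MDP R Sigma1) (M2 : MDP R Sigma2).
Local Notation X1 := (mdp_st M1 * mdp_act M1)%type.
Local Notation X2 := (mdp_st M2 * mdp_act M2)%type.
Hypotheses (M1wf : mdp_wf M1) (M2wf : mdp_wf M2).
Variables (pr : mdp_st M1 -> mdp_st M2) (ac : X1 -> option (mdp_act M2)).
Definition simmap (x : X1) : option X2 := omap (pair (pr x.1)) (ac x).
Hypothesis ac_avail : forall x m, mdp_avail M1 x.1 x.2 -> ac x = Some m ->
  mdp_avail M2 (pr x.1) m.
Hypothesis ac_trans : forall x m s, mdp_avail M1 x.1 x.2 -> ac x = Some m ->
  \sum_(t | pr t == s) mdp_trans M1 x.1 x.2 t <= mdp_trans M2 (pr x.1) m s.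
Variables (tau : strategy M1) (t0 : mdp_st M1).
Hypothesis tauwf : strategy_wf tau.
Local Notation c := (cyl_prob tau t0).
Implicit Types (k : history M2) (h : history M1).

Definition simweight k : R :=
  \sum_(h <- words _ (size k) | map simmap h == map Some k) c h.

Lemma simweight_ge0 k : 0 <= simweight k.
Proof. by apply: sumr_ge0 => h _; exact: cyl_prob_ge0. Qed.

Lemma simweight_rcons k y : simweight (rcons k y) =
  \sum_(h <- words _ (size k) | map simmap h == map Some k)
    \sum_(x | simmap x == Some y) c (rcons h x).
Proof.
rewrite /simweight size_rcons big_mkcond sum_wordsS [RHS]big_mkcond.
apply: eq_bigr => h _; under eq_bigr do rewrite !map_rcons eqseq_rcons.
case: (map _ _ == _) => /=; first by rewrite [RHS]big_mkcond.
by rewrite big1.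
Qed.

Lemma simweight_unavailable k y :
  ~~ mdp_avail M2 y.1 y.2 -> simweight (rcons k y) = 0.
Proof.
move=> yN; rewrite simweight_rcons big1// => h _; rewrite big1// => x /eqP.
rewrite /simmap; case acx : (ac x) => [m|]//= -[ym].
apply: cyl_prob_unavailable => //; apply: contra yN => xa.
by rewrite -ym/=; exact: ac_avail.
Qed.

Lemma sum_simweight_rcons k s : \sum_m simweight (rcons k (s, m)) <=
  \sum_(h <- words _ (size k) | map simmap h == map Some k)
    \sum_(x | (pr x.1 == s) && (ac x != None)) c (rcons h x).
Proof.
under eq_bigr do rewrite simweight_rcons.
rewrite exchange_big/=; apply: ler_sum => h _.
under eq_bigr do rewrite big_mkcond.
rewrite exchange_big/= [leRHS]big_mkcond; apply: ler_sum => x _.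
rewrite /simmap; case acx : (ac x) => [m|]/=; last by rewrite big1 ?andbF.
case: eqP => [<-|ns] /=; last first.
  by rewrite big1// => m' _; case: eqP => // -[].
rewrite (bigD1 m)//= eqxx big1 ?addr0// => m' /negbTE mm'.
by case: eqP => // -[] /esym/eqP; rewrite mm'.
Qed.

(** Whatever [tau] does, the mass moving from [y] to [s] is bounded by summing [ac_trans] over the
    histories that project to [rcons k y]. Mass is lost where [tau] meets a dead end or a letter
    without image. *)
Lemma simweight_step k y s : \sum_m simweight (rcons (rcons k y) (s, m)) <=
  simweight (rcons k y) * mdp_trans M2 y.1 y.2 s.
Proof.
apply: le_trans (sum_simweight_rcons _ _) _.
rewrite /simweight size_rcons mulr_suml big_mkcond [leRHS]big_mkcond.
rewrite !sum_wordsS; apply: ler_sum => h _; apply: ler_sum => x _.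
rewrite !map_rcons eqseq_rcons; case: (_ == map Some k) => //=.
case: eqP => //; rewrite /simmap; case acx : (ac x) => [m|]//= -[<-]/=.
have [xa|xa] := boolP (mdp_avail M1 x.1 x.2); last first.
  rewrite big1 => [|z _]; first by rewrite cyl_prob_unavailable// mul0r.
  by rewrite cyl_prob_rcons cyl_prob_unavailable// mul0r.
apply: le_trans (ler_wpM2l (cyl_prob_ge0 t0 M1wf tauwf _) (ac_trans s xa acx)).
rewrite mulr_sumr big_mkcond sum_letters [leRHS]big_mkcond.
apply: ler_sum => t _; case: eqP => _ /=; last by rewrite big1.
apply: le_trans (cyl_prob_step t0 M1wf tauwf h x t).
by apply: ler_sum => a _; case: ifP => // _; exact: cyl_prob_ge0.
Qed.

(** Where the projected weight vanishes there is nothing to condition on; a point mass on an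
    available action keeps [strategy_wf] true. *)
Definition default_strategy (s : mdp_st M2) (m : mdp_act M2) : R :=
  if [pick m' | mdp_avail M2 s m'] is Some m' then (m == m')%:R else 0.

(* Conditional probabilities under the projected weight. *)
Definition sim_strategy : strategy M2 := fun k s m =>
  let tot := \sum_m' simweight (rcons k (s, m')) in
  if tot == 0 then default_strategy s m else simweight (rcons k (s, m)) / tot.

Lemma sim_strategy_wf : strategy_wf sim_strategy.
Proof.
split; [|split] => k s.
- move=> m; rewrite /sim_strategy/= /default_strategy; case: ifP => _.
    by case: pickP.
  by rewrite divr_ge0 ?simweight_ge0 ?sumr_ge0// => *; exact: simweight_ge0.
- move=> m mN; rewrite /sim_strategy/= simweight_unavailable// mul0r.
  case: ifP => // _; rewrite /default_strategy; case: pickP => // m' sm'.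
  by case: eqP => // mm'; rewrite mm' sm' in mN.
- move=> [m sm]; rewrite /sim_strategy/=; case: eqP => [_|/eqP tot].
    rewrite /default_strategy; case: pickP => [m' _|/(_ m)]; last by rewrite sm.
    by rewrite (bigD1 m')//= eqxx big1 ?addr0// => i /negbTE ->.
  by rewrite -mulr_suml divff.
Qed.

Lemma simweight_factor k s m : simweight (rcons k (s, m)) =
  (\sum_m' simweight (rcons k (s, m'))) * sim_strategy k s m.
Proof.
rewrite /sim_strategy/=; case: eqP => [tot0|/eqP tot]; last by rewrite mulrC divfK.
rewrite tot0 mul0r; apply/eqP; move/eqP: tot0; rewrite psumr_eq0.
  by move=> /allP/(_ m); rewrite mem_index_enum => /(_ isT).
by move=> *; exact: simweight_ge0.
Qed.

(** By induction on [k]: [sim_strategy] splits the total weight at a state exactly, and that total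
    is at most the weight arriving there. Equality can fail, since normalising gives back the mass
    that [tau] loses. *)
Lemma simweight_le k : k != [::] ->
  simweight k <= cyl_prob sim_strategy (pr t0) k.
Proof.
have [nu0 _] := sim_strategy_wf.
elim/last_ind: k => // k [s m]; case/lastP: k => [_ _|k y IH _].
  rewrite /= mulr1 -[[:: (s, m)]]/(rcons [::] (s, m)) simweight_factor.
  apply: ler_wpM2r => //; apply: le_trans (sum_simweight_rcons _ _) _.
  rewrite /= big_cons big_nil/= addr0 big_mkcond.
  apply: (@le_trans _ _ (\sum_x c [:: x] * (pr x.1 == s)%:R)).
    apply: ler_sum => x _; have cx := cyl_prob_ge0 t0 M1wf tauwf [:: x].
    case: ifP => [/andP[-> _]|_]; first by rewrite (mulr1 (c _)).
    exact: mulr_ge0.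
  have F0 : 0 <= (pr t0 == s)%:R :> R by [].
  have := @cyl_prob_init _ _ _ _ t0 tauwf (fun t => (pr t == s)%:R) F0.
  by rewrite [in leRHS]eq_sym.
rewrite simweight_factor cyl_prob_rcons mulrA; apply: ler_wpM2r => //.
apply: le_trans (simweight_step _ _ _) _.
have [ya|yN] := boolP (mdp_avail M2 y.1 y.2).
  by apply: ler_wpM2r; [exact: (M2wf ya).1|apply: IH; case: (k)].
by rewrite simweight_unavailable// mul0r cyl_prob_unavailable ?mul0r//;
  exact: sim_strategy_wf.
Qed.

(** Serves twice: to forget the automaton component of a product, and to forget the memory of a
    chain inside a product. *)
Lemma simulation (P1 : {measure set (runSpace M1) -> \bar R}) :
  induced_measure tau t0 P1 ->
  exists2 nu : strategy M2, strategy_wf nu &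
  exists2 P2 : {measure set (runSpace M2) -> \bar R},
    induced_measure nu (pr t0) P2 &
    forall E, measurable E -> E `<=` infinite_runs M2 ->
      (P1 (pathmap simmap @^-1` E) <= P2 E)%E.
Proof.
move=> P1i; exists sim_strategy; first exact: sim_strategy_wf.
have [P2 P2i] := exists_induced (pr t0) M2wf sim_strategy_wf.
exists P2 => // E mE Einf; apply: measure_pathmap_dom => //.
- exact: le_lt_trans (induced_le1 tauwf P1i) (ltry _).
- exact: le_lt_trans (induced_le1 sim_strategy_wf P2i) (ltry _).
move=> k k0; rewrite preimage_pathmap_cyl (measure_ev _ P1i.1); last by case: (k) k0.
by rewrite P2i.1// lee_fin simweight_le.
Qed.

End Simulation.
(** * Breakpoint construction *)

(** König's lemma for a graph with finite layers. [A k q] says that paths of every length start from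
    [q] at level [k]; some successor inherits this, since otherwise a path longer than the bounds of
    all the finitely many successors would be contradictory. *)
Lemma infinite_chain (Q : finType) (e : nat -> Q -> Q -> Prop) (q0 : Q) :
  (forall n, exists c : nat -> Q, c 0%N = q0 /\
    forall k, (k < n)%N -> e k (c k) (c k.+1)) ->
  exists c : nat -> Q, c 0%N = q0 /\ forall k, e k (c k) (c k.+1).
Proof.
pose A k q := forall n, exists c : nat -> Q, c 0%N = q /\
  forall i, (i < n)%N -> e (k + i)%N (c i) (c i.+1).
move=> A0; have step (kq : nat * Q) :
    exists q', A kq.1 kq.2 -> e kq.1 kq.2 q' /\ A kq.1.+1 q'.
  case: kq => k q; apply: contrapT => /=.
  move=> /forallNP H; have Akq : A k q by apply: contrapT => nA; apply: (H q).
  have /choice[b bP] q' : exists n, e k q q' -> ~ exists c : nat -> Q, c 0%N = q' /\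
      forall i, (i < n)%N -> e (k.+1 + i)%N (c i) (c i.+1).
    apply: contrapT => /forallNP Hn; apply: (H q') => _; split.
      by apply: contrapT => ne; apply: (Hn 0%N).
    by move=> n; apply: contrapT => nc; apply: (Hn n).
  have [c [c0 cP]] := Akq (\max_q' b q').+1.
  have e1 : e k q (c 1%N) by have := cP 0%N erefl; rewrite addn0 c0.
  apply: (bP _ e1); exists (fun i => c i.+1); split=> // i ib.
  rewrite addSnnS; apply: cP; rewrite ltnS (leq_trans ib)//.
  exact: leq_bigmax.
have [f fP] := choice step.
pose c := fix c k := if k is k'.+1 then f (k', c k') else q0.
have Ac k : A k (c k) by elim: k => [//|k IH]; exact: (fP (k, c k) IH).2.
by exists c; split=> // k; exact: (fP (k, c k) (Ac k)).1.
Qed.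

Lemma inf_often_exists (T : finType) (A : T -> nat -> bool) :
  (forall n, exists2 m, (n <= m)%N & exists p, A p m) ->
  exists p, forall n, exists2 m, (n <= m)%N & A p m.
Proof.
move=> H; apply: contrapT => /forallNP H'.
have /choice[b bP] p : exists n, forall m, (n <= m)%N -> ~~ A p m.
  apply: contrapT => /forallNP Hp; apply: (H' p) => n.
  apply: contrapT => Hn; apply: (Hp n) => m nm; apply/negP => Am; apply: Hn.
  by exists m.
have [m bm [p Apm]] := H (\max_p b p).
by have /negP := bP p m (leq_trans (leq_bigmax p) bm).
Qed.

Section DeterministicMemory.
Variables (Sigma : finType) (Z : Type) (upd : Z -> Sigma -> Z) (z0 : Z).

Fixpoint memory_at (w : nat -> Sigma) t : Z :=
  if t is t'.+1 then upd (memory_at w t') (w t') else z0.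

End DeterministicMemory.

Section Breakpoint.
Variables (Sigma : finType) (N : NBW Sigma).
Local Notation Q := (nbw_state N).
Local Notation F := (nbw_final N).
Implicit Types (w : nat -> Sigma) (S O : {set Q}) (p q : Q).

Definition post S a := (\bigcup_(q in S) nbw_delta N q a)%SET.

Lemma mem_post S a q' : (q' \in post S a) = [exists q in S, q' \in nbw_delta N q a].
Proof. by apply/bigcupP/exists_inP => -[q]; exists q. Qed.

Lemma postS S S' a : S \subset S' -> post S a \subset post S' a.
Proof.
move=> /fintype.subsetP SS; apply/fintype.subsetP => q; rewrite !mem_post => /exists_inP[p pS pq].
by apply/exists_inP; exists p => //; exact: SS.
Qed.

(* [SO.1] is the set of states reached so far and [SO.2] collects those reached
   through a final state since the last breakpoint, the last time the two sets
   were equal. *)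
Definition bp_step (SO : {set Q} * {set Q}) a : {set Q} * {set Q} :=
  (post SO.1 a,
   post (if SO.2 == SO.1 then SO.1 :&: F else SO.2 :|: SO.1 :&: F)%SET a).

(** The pair of empty sets, given by [bp_start] to unreachable states and left behind when all runs
    die, must not count as a breakpoint. *)
Definition bp_accept (SO : {set Q} * {set Q}) := (SO.2 == SO.1) && (SO.1 != finset.set0)%SET.

Definition bp_start S : {ffun Q -> {set Q} * {set Q}} :=
  [ffun p => ((if p \in S then [set p] else finset.set0), finset.set0)%SET].

Variable j : nat.

(* The memory holds the states reachable so far, the number of letters left
   before time [j], and one breakpoint construction per state, started at
   time [j]. *)
Definition bp_memory :=
  ({set Q} * 'I_j.+1 * {ffun Q -> {set Q} * {set Q}})%type.

Definition bp_upd (z : bp_memory) a : bp_memory :=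
  let S' := post z.1.1 a in
  if z.1.2 == 0%N :> nat then (S', z.1.2, [ffun p => bp_step (z.2 p) a])
  else (S', inord z.1.2.-1, bp_start S').

Definition bp_init : bp_memory :=
  ([set nbw_init N]%SET, ord_max, bp_start [set nbw_init N]%SET).

Definition bp_final (z : bp_memory) := [exists p, bp_accept (z.2 p)].

Local Notation mem w := (memory_at bp_upd bp_init w).

Definition reachable w t : {set Q} := memory_at post [set nbw_init N]%SET w t.

(** Until the counter is 0 every letter restarts all the constructions, so at time [j] they are
    fresh. *)
Lemma bp_memory_before w t : (t <= j)%N ->
  mem w t = (reachable w t, inord (j - t), bp_start (reachable w t)).
Proof.
elim: t => [|t IH] tj /=.
  by rewrite subn0; congr (_, _, _); apply/val_inj; rewrite /= inordK.
rewrite (IH (ltnW tj)) /bp_upd inordK ?ltnS ?leq_subr//.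
rewrite subn_eq0 leqNgt tj/=; congr (_, _, _); congr inord; lia.
Qed.

Lemma bp_memory_after w t : (j <= t)%N -> (mem w t).1.2 = 0%N :> nat.
Proof.
move=> /subnK <-; elim: (t - j)%N => [|d IH].
  by rewrite add0n bp_memory_before//= subnn inordK.
by rewrite addSn/= /bp_upd IH /= IH.
Qed.

Lemma bp_memory_start w p :
  (mem w j).2 p = ((if p \in reachable w j then [set p] else finset.set0), finset.set0)%SET.
Proof. by rewrite bp_memory_before//= ffunE. Qed.

Lemma bp_memoryS w t p : (j <= t)%N ->
  (mem w t.+1).2 p = bp_step ((mem w t).2 p) (w t).
Proof.
move=> jt /=; rewrite /bp_upd; have := bp_memory_after w jt.
by move=> ->; rewrite ffunE.
Qed.

Lemma reachable_run w t q : q \in reachable w t -> exists rho : nat -> Q,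
  [/\ rho 0%N = nbw_init N, rho t = q &
      forall i, (i < t)%N -> rho i.+1 \in nbw_delta N (rho i) (w i)].
Proof.
elim: t q => [|t IH] q /=; first by rewrite inE => /eqP->; exists (fun=> nbw_init N).
rewrite mem_post => /exists_inP[p /IH[rho [r0 rt rP]] pq].
exists (fun i => if (i <= t)%N then rho i else q); split=> //; first by rewrite ltnn.
move=> i; rewrite ltnS => it; rewrite it; case: ltngtP it => // [it _|-> _].
  exact: rP.
by rewrite rt.
Qed.

(** By pigeonhole one [p] has infinitely many breakpoints. Every state reached from [p] has a
    backward path to [p], and König's lemma merges these into one infinite run. Its edges [e] also
    record where membership in the second set comes from, which forces a final state between two
    breakpoints. *)
Lemma bp_sound w :
  (forall n, exists2 m, (n <= m)%N & bp_final (mem w m)) -> nbw_lang N w.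
Proof.
move=> inf; have [p pinf] : exists p, forall n, exists2 m, (n <= m)%N &
    bp_accept ((mem w m).2 p).
  apply: inf_often_exists => n; have [m nm /existsP[p pm]] := inf n.
  by exists m => //; exists p.
pose S d := ((mem w (j + d)%N).2 p).1; pose O d := ((mem w (j + d)%N).2 p).2.
have SO d : (mem w (j + d)%N).2 p = (S d, O d) by exact: surjective_pairing.
have step d : (S d.+1, O d.+1) = bp_step (S d, O d) (w (j + d)%N).
  by rewrite -!SO addnS bp_memoryS// leq_addr.
have SS d : S d.+1 = post (S d) (w (j + d)%N) by case: (step d).
have OO d : O d.+1 = post (if O d == S d then S d :&: F else O d :|: S d :&: F)%SET
    (w (j + d)%N) by case: (step d).
have acc n : exists2 d, (n <= d)%N & (O d == S d) && (S d != finset.set0)%SET.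
  have [m nm mp] := pinf (j + n)%N; exists (m - j)%N; first by lia.
  have jm : (j + (m - j) = m)%N by lia.
  by have := SO (m - j)%N; rewrite jm => E; move: mp; rewrite E.
have Sn d : (S d != finset.set0)%SET.
  have [m dm /andP[_]] := acc d; rewrite -(subnK dm).
  elim: (m - d)%N => // k IH; rewrite addSn SS => H; apply: IH.
  apply: contraNneq H => ->; rewrite -finset.subset0; apply/fintype.subsetP => q.
  by rewrite mem_post => /exists_inP[q']; rewrite inE.
have pR : p \in reachable w j.
  have := Sn 0%N; rewrite /S addn0 bp_memory_start/=.
  by case: ifP => //; rewrite eqxx.
have S0 : S 0%N = [set p]%SET by rewrite /S addn0 bp_memory_start/= pR.
have Osub d : O d \subset S d.
  elim: d => [|d IH]; first by rewrite /O addn0 bp_memory_start finset.sub0set.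
  rewrite SS OO postS//; case: ifP => _; first exact: finset.subsetIl.
  by rewrite finset.subUset IH finset.subsetIl.
pose e d q q' := [/\ q \in S d, q' \in S d.+1, q' \in nbw_delta N q (w (j + d)%N) &
  q' \in O d.+1 -> if O d == S d then q \in F else (q \in O d) || (q \in F)].
have back d q' : q' \in S d.+1 -> exists q, e d q q'.
  move=> q'S; have [q'O|q'O] := boolP (q' \in O d.+1).
    move: (q'O); rewrite OO mem_post => /exists_inP[q qin qq']; exists q.
    case: ifP qin => OS.
      by rewrite inE => /andP[qS qF]; split=> //; rewrite OS.
    rewrite !inE => qin; have qS : q \in S d.
      by case/orP: qin => [/(fintype.subsetP (Osub d))//|/andP[]].
    split=> //; rewrite OS => _; by case/orP: qin => [->//|/andP[_ ->]]; rewrite orbT.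
  move: (q'S); rewrite SS mem_post => /exists_inP[q qS qq']; exists q; split=> //.
  by rewrite (negbTE q'O).
have chain n q : q \in S n -> exists c : nat -> Q, [/\ c 0%N \in S 0%N, c n = q &
    forall k, (k < n)%N -> e k (c k) (c k.+1)].
  elim: n q => [|n IH] q qS; first by exists (fun=> q).
  have [q' eq'] := back n q qS; have [q'S _ _ _] := eq'.
  have [c [c0 cn ce]] := IH q' q'S.
  exists (fun i => if (i <= n)%N then c i else q); split=> //; first by rewrite ltnn.
  move=> i; rewrite ltnS => it; rewrite it; case: ltngtP it => // [it _|-> _].
    exact: ce.
  by rewrite cn.
have [c [c0 ce]] : exists c : nat -> Q, c 0%N = p /\ forall k, e k (c k) (c k.+1).
  apply: infinite_chain => n; have /finset.set0Pn[q /chain[c [c0 _ ce]]] := Sn n.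
  by exists c; split=> //; move: c0; rewrite S0 inE => /eqP.
have [rho [r0 rj rP]] := reachable_run pR.
exists (fun i => if (i < j)%N then rho i else c (i - j)%N); split.
  split; first by case: ifP => // /negbT; rewrite -leqNgt leqn0 => /eqP j0; rewrite c0 -rj j0.
  move=> i; case: (ltnP i.+1 j) => ij; first by rewrite (ltnW ij) rP ?(ltnW ij).
  move: ij; rewrite leq_eqVlt => /predU1P[ij|ij].
    have -> : (i < j)%N by lia.
    have -> : (i.+1 - j = 0)%N by lia.
    by rewrite c0 -rj [in rho j]ij rP// ij.
  rewrite ltnNge -ltnS ij/= subSn//; have [_ _ + _] := ce (i - j)%N.
  by rewrite subnKC.
move=> n; have [d1 nd1 _] := acc n; have [d1' d1d1' /andP[/eqP OS1 _]] := acc d1.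
have [d2 d12 /andP[/eqP OS2 _]] := acc d1'.+1.
suff [d d1d cF] : exists2 d, (d1' <= d)%N & c d \in F.
  exists (j + d)%N; first by rewrite (leq_trans nd1)// (leq_trans d1d1')// (leq_trans d1d)// leq_addl.
  by rewrite /= ltnNge leq_addr/= addKn.
(* The second set restarts from final states at the breakpoint [d1']. A run avoiding [F] from then
   on stays outside it, yet at the breakpoint [d2] it is all of [S d2]. *)
apply: contrapT => nF; have nF' d : (d1' <= d)%N -> c d \notin F.
  by move=> d1d; apply/negP => cF; apply: nF; exists d.
have nO d : (d1' < d)%N -> c d \notin O d.
  move=> d1d; rewrite -(subnK d1d); elim: (d - d1'.+1)%N => [|k IH].
    rewrite add0n; apply/negP => cO; have [_ _ _ /(_ cO)] := ce d1'.
    by rewrite OS1 eqxx; apply/negP/nF'.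
  rewrite addSn; apply/negP => cO; have [_ _ _ /(_ cO)] := ce (k + d1'.+1)%N.
  rewrite (negbTE IH) (negbTE (nF' _ _)); last by lia.
  by case: ifP.
by have := nO d2 d12; rewrite OS2; have [-> _ _ _] := ce d2.
Qed.

End Breakpoint.

Section BreakpointComplete.
Variables (Sigma : finType) (N : NBW Sigma).
Local Notation Q := (nbw_state N).
Local Notation F := (nbw_final N).

(* The sets of states reached from the accepting run at two different times
   eventually coincide if the earlier time is late enough, since otherwise they
   would form arbitrarily long strictly decreasing chains. From then on, a visit
   to a final state spreads to the whole set and causes a breakpoint. *)
Lemma bp_complete (w : nat -> Sigma) : nbw_lang N w -> exists j0, forall j, (j0 <= j)%N ->
  forall n, exists2 m, (n <= m)%N & bp_final (memory_at (@bp_upd _ N j) (bp_init N j) w m).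
Proof.
move=> [rho [[r0 rS] rF]].
pose U i := fix U n := if n is n'.+1 then post (U n') (w (i + n')%N) else [set rho i]%SET.
pose V i t := U i (t - i)%N.
have Vii i : V i i = [set rho i]%SET by rewrite /V subnn.
have VS i t : (i <= t)%N -> V i t.+1 = post (V i t) (w t).
  by move=> it; rewrite /V subSn//= subnKC.
have rV i t : (i <= t)%N -> rho t \in V i t.
  move=> /subnK <-; elim: (t - i)%N => [|d IH]; first by rewrite add0n Vii inE.
  rewrite addSn VS ?leq_addl// mem_post; apply/exists_inP; exists (rho (d + i)%N) => //.
have Vsub i i' t : (i <= i')%N -> (i' <= t)%N -> V i' t \subset V i t.
  move=> ii' /subnK <-; elim: (t - i')%N => [|d IH].
    by rewrite add0n Vii finset.sub1set rV.
  by rewrite addSn !VS ?postS// ?leq_addl// (leq_trans ii')// leq_addl.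
have Vmerge i i' t t' : (i <= i')%N -> (i' <= t)%N -> (t <= t')%N ->
    V i t = V i' t -> V i t' = V i' t'.
  move=> ii' i't /subnK <- VV; elim: (t' - t)%N => // d IH.
  by rewrite addSn !VS ?IH//; lia.
have [i0 i0P] : exists i0, forall i, (i0 <= i)%N -> exists2 t, (i <= t)%N & V i0 t = V i t.
  (* Induction on an eventual bound of the sizes: if [V i] never merges with some later [V i'], then
     [V i'] is always strictly smaller. *)
  suff H b : (exists i, forall t, (i <= t)%N -> (#|V i t| <= b)%N) ->
      exists i0, forall i, (i0 <= i)%N -> exists2 t, (i <= t)%N & V i0 t = V i t.
    by apply: (H #|{: Q}|); exists 0%N => t _; exact: max_card.
  elim: b => [|b IH] [i ib].
    have := ib i (leqnn _); rewrite leqn0 cards_eq0 => /eqP V0.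
    by have := rV i i (leqnn _); rewrite V0 inE.
  case: (pselect (forall i', (i <= i')%N -> exists2 t, (i' <= t)%N & V i t = V i' t)).
    by exists i.
  move=> /existsNP[i' /not_implyP[ii' nm]]; apply: IH; exists i' => t i't.
  rewrite -ltnS; apply: leq_trans (ib t (leq_trans ii' i't)).
  apply: fintype.proper_card; rewrite finset.properEneq Vsub// andbT.
  by apply/eqP => e; apply: nm; exists t.
exists i0 => j i0j n; set mem := memory_at _ _ w.
pose S t := ((mem t).2 (rho j)).1; pose O t := ((mem t).2 (rho j)).2.
have SO t : (mem t).2 (rho j) = (S t, O t) by exact: surjective_pairing.
have step t : (j <= t)%N -> (S t.+1, O t.+1) = bp_step (S t, O t) (w t).
  by move=> jt; rewrite -!SO bp_memoryS.
have rR : rho j \in reachable N w j.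
  elim: (j) => [|i IH] /=; first by rewrite r0 inE.
  by rewrite mem_post; apply/exists_inP; exists (rho i).
have start := bp_memory_start j w (rho j); rewrite -/mem rR SO in start.
have SE t : (j <= t)%N -> S t = V j t.
  move=> /subnK <-; elim: (t - j)%N => [|d IH].
    by rewrite add0n Vii; case: start.
  by rewrite addSn VS ?leq_addl// -IH; case: (step (d + j)%N (leq_addl _ _)).
have Osub t : (j <= t)%N -> O t \subset S t.
  move=> /subnK <-; elim: (t - j)%N => [|d IH].
    by rewrite add0n; case: start => _ ->; rewrite finset.sub0set.
  rewrite addSn; case: (step (d + j)%N (leq_addl _ _)) => -> ->; apply: postS.
  case: ifP => _; first exact: finset.subsetIl.
  by rewrite finset.subUset IH finset.subsetIl.
apply: contrapT => nacc.
have nOS t : (n <= t)%N -> (j <= t)%N -> O t != S t.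
  move=> nt jt; apply/negP => OS; apply: nacc; exists t => //.
  apply/existsP; exists (rho j); rewrite SO /bp_accept/= OS/=.
  by apply/finset.set0Pn; exists (rho t); rewrite SE// rV.
(* Without breakpoints nothing is discarded, so all that is reachable from the final state [rho j']
   remains in the second set. *)
have [j' nj' j'F] := rF (n + j)%N.
have jj' : (j <= j')%N by lia.
have OV t : (j' < t)%N -> V j' t \subset O t.
  move=> /subnK <-; elim: (t - j'.+1)%N => [|d IH].
    rewrite add0n VS// Vii; have [] := step j' jj'; rewrite (negbTE (nOS _ _ _))//; last by lia.
    move=> _ ->; apply: postS; rewrite finset.sub1set !inE SE// rV//.
    by move: j'F => /= ->; rewrite orbT.
  have jd : (j <= d + j'.+1)%N by lia.
  rewrite addSn VS; last by lia.
  have [] := step _ jd; rewrite (negbTE (nOS _ _ _))//; last by lia.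
  by move=> _ ->; apply: postS; apply: fintype.subset_trans IH (finset.subsetUl _ _).
have [t j't Vt] := i0P j' (leq_trans i0j jj').
(* [V j] lies between [V j'] and [V i0], which have merged by time [t]. One more step is taken
   because [OV] needs a time strictly after [j']. *)
have Vt1 : V j t.+1 = V j' t.+1.
  apply/eqP; rewrite finset.eqEsubset; apply/andP; split; last by apply: Vsub; lia.
  by rewrite -(Vmerge i0 j' t t.+1)//; [apply: Vsub; lia|lia].
have jt1 : (j <= t.+1)%N by lia.
have /negP[] := nOS t.+1 ltac:(lia) jt1.
by rewrite finset.eqEsubset Osub//= SE// Vt1 OV// ltnS.
Qed.

End BreakpointComplete.

(** * The language event as a union of Büchi events with finite memory *)

Section SemEvent.
Variables (R : realType) (Sigma : finType) (M : MDP R Sigma) (N : NBW Sigma).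

Definition history_memory Z (upd : Z -> Sigma -> Z) z0 (h : history M) : Z :=
  foldl (fun z x => upd z (mdp_lab M x.1)) z0 h.

Lemma history_memory_rcons Z (upd : Z -> Sigma -> Z) z0 h x :
  history_memory upd z0 (rcons h x) = upd (history_memory upd z0 h) (mdp_lab M x.1).
Proof. exact: foldl_rcons. Qed.

Lemma history_memory_mkseq Z (upd : Z -> Sigma -> Z) z0 (r : nat -> mdp_st M * mdp_act M) n :
  history_memory upd z0 (mkseq r n) = memory_at upd z0 (fun n => mdp_lab M (r n).1) n.
Proof. by elim: n => // n IH; rewrite mkseqS history_memory_rcons IH. Qed.

Definition buchi_event Z (upd : Z -> Sigma -> Z) z0 (fin : pred Z) : set (runSpace M) :=
  lim_sup_set (fun n => ev n (fun h => fin (history_memory upd z0 h))).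

Lemma lim_sup_ev_infinite (phi : nat -> pred (history M)) :
  lim_sup_set (fun n => ev n (phi n)) `<=` infinite_runs M.
Proof.
move=> w wb n _; have [m nm [h hm [hw _]]] := wb n I.
have nh : (n <= size h)%N by rewrite hm.
exists (take n h); first by rewrite size_takel.
split=> // i; rewrite size_takel// => ilt; rewrite hw ?(leq_trans ilt)//.
by rewrite -{1}(cat_take_drop n h) onth_cat size_takel// ilt.
Qed.

Lemma ev_run (w : runSpace M) r n (phi : pred (history M)) :
  run_states w r -> ev n phi w <-> phi (mkseq r n).
Proof.
move=> wr; have rn : cyl (mkseq r n : history M) w.
  move=> i; rewrite size_mkseq => ilt; rewrite wr.
  by rewrite onthE -map_comp (nth_map 0%N) ?size_iota// nth_iota.
split=> [[h hn [hw ph]]|ph]; last by exists (mkseq r n); rewrite ?size_mkseq.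
by rewrite (@cyl_uniq _ _ _ (mkseq r n) h w) ?size_mkseq.
Qed.

Lemma buchi_eventP Z (upd : Z -> Sigma -> Z) z0 (fin : pred Z) r (w : runSpace M) :
  run_states w r -> buchi_event upd z0 fin w <->
  forall n, exists2 m, (n <= m)%N & fin (memory_at upd z0 (fun n => mdp_lab M (r n).1) m).
Proof.
move=> wr; split=> [wb n|H n _].
  have [m nm /(ev_run _ _ wr)] := wb n I; exists m => //.
  by rewrite -history_memory_mkseq.
have [m nm fm] := H n; exists m => //; apply/(ev_run _ _ wr).
by rewrite history_memory_mkseq.
Qed.

Definition bp_event j : set (runSpace M) :=
  buchi_event (@bp_upd _ N j) (bp_init N j) (@bp_final _ N j).

Lemma bp_event_sub j : bp_event j `<=` sem_event M N.
Proof.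
move=> w wb; have /infinite_runsP[r wr] := lim_sup_ev_infinite wb.
exists r; split=> //; apply: (@bp_sound _ _ j).
by have /(buchi_eventP _ _ _ wr) := wb.
Qed.

(** The intersections grow with [j], so continuity from below applies to their union; each is
    contained in a single [bp_event]. *)
Lemma sem_event_sub :
  sem_event M N `<=` \bigcup_j \bigcap_(i in [set i | (j <= i)%N]) bp_event i.
Proof.
move=> w [r [wr /bp_complete[j jP]]]; exists j => // i ji.
exact/(buchi_eventP _ _ _ wr)/jP.
Qed.

Lemma measurable_bp_event j : measurable (bp_event j).
Proof. exact: measurable_buchi. Qed.

(** The definition quantifies over uncountably many automaton runs; soundness and completeness
    replace this by a countable union. *)
Lemma measurable_sem_event : measurable (sem_event M N).
Proof.
rewrite (_ : sem_event M N = \bigcup_j bp_event j).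
  by apply: bigcupT_measurable => j; exact: measurable_bp_event.
apply/seteqP; split=> [w /sem_event_sub[j _ /(_ j (leqnn j))]|w [j _ /bp_event_sub//]].
by exists j.
Qed.

Lemma sem_event_infinite : sem_event M N `<=` infinite_runs M.
Proof. by move=> w [r [wr _]]; apply/infinite_runsP; exists r. Qed.

End SemEvent.
(** * Büchi objectives on finite MDPs *)

Section BuchiRegion.
Variables (R : realType) (T A : finType) (av : T -> A -> bool) (p : T -> A -> T -> R).
Hypothesis pwf : forall s m, av s m -> (forall t, 0 <= p s m t) /\ \sum_t p s m t = 1.
Variable B : pred T.
Implicit Types (X Y : {set T}) (s t : T) (m : A).

Definition expectation (V : T -> R) s m := \sum_t p s m t * V t.

Lemma le_expectation V V' s m : av s m -> (forall t, 0 < p s m t -> V t <= V' t) ->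
  expectation V s m <= expectation V' s m.
Proof.
move=> sm VV; apply: ler_sum => t _; have := (pwf sm).1 t.
rewrite le_eqVlt => /predU1P[<-|pt]; first by rewrite !mul0r.
by rewrite ler_pM2l// VV.
Qed.

Lemma expectation_const (a : R) s m : av s m -> expectation (fun=> a) s m = a.
Proof. by move=> sm; rewrite /expectation -mulr_suml (pwf sm).2 mul1r. Qed.

Definition safe X s m := av s m && [forall t, (0 < p s m t) ==> (t \in X)].

(** Turns the mere possibility of a favourable successor into a uniform gain in expectation. *)
Lemma min_prob : exists e : R, [/\ 0 < e, e <= 1 &
  forall s m t, 0 < p s m t -> e <= p s m t].
Proof.
exists (\big[Num.min/1]_(x : T * A * T | 0 < p x.1.1 x.1.2 x.2) p x.1.1 x.1.2 x.2); split.
- by apply: lt_bigmin.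
- by apply: bigmin_le_id.
- by move=> s m t pst; apply: (@bigmin_le_cond _ _ _ _ (s, m, t)).
Qed.

Lemma expectation_gap e (th : R) V s m t0 : av s m ->
  (0 < p s m t0 -> e <= p s m t0) -> 0 <= th -> 0 < p s m t0 ->
  (forall t, V t <= 1) -> V t0 <= 1 - th -> expectation V s m <= 1 - e * th.
Proof.
move=> sm ep th0 pt0 V1 Vt0; have [p0 p1] := pwf sm.
apply: (@le_trans _ _ (1 - p s m t0 * th)); last by rewrite lerD2l lerN2 ler_wpM2r// ep.
rewrite /expectation (bigD1 t0)//= -[X in _ <= X - _]p1.
rewrite [X in _ <= X - _](bigD1 t0)//=.
have : \sum_(i | i != t0) p s m i * V i <= \sum_(i | i != t0) p s m i.
  by apply: ler_sum => t _; rewrite ler_piMr.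
have : p s m t0 * V t0 <= p s m t0 * (1 - th) by rewrite ler_pM2l.
rewrite mulrBr mulr1; lra.
Qed.

(* [Y] is the set of states from which, using actions that surely stay in [X],
   the set [B] can be reached; [U] is the potential of the reaching strategy. *)
Lemma attractor_potential X : exists Y (a : T -> option A) (U : T -> R) (d : R),
  [/\ 0 < d, forall s, 0 <= U s <= 1,
      forall s, s \in Y -> exists m, [/\ a s = Some m, safe X s m &
        expectation (fun t => if B t then 0 else U t) s m <= U s - d] &
      forall s m t, s \notin Y -> safe X s m -> 0 < p s m t -> ~~ B t && (t \notin Y)].
Proof.
have [e [e0 e1 eP]] := min_prob.
(* [Y] grows by one state per round. Since [U] is 1 off [Y] and at most [1 - th] on [Y], giving a
   new state a smaller value never spoils the inequalities already obtained. *)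
suff H n Y (a : T -> option A) (U : T -> R) (d th : R) : (#|~: Y| <= n)%N ->
   [/\ 0 < d, 0 < th <= 1, forall s, 0 <= U s <= 1,
    forall s, (s \in Y -> U s <= 1 - th) /\ (s \notin Y -> U s = 1) &
    forall s, s \in Y -> exists m, [/\ a s = Some m, safe X s m &
        expectation (fun t => if B t then 0 else U t) s m <= U s - d]] ->
   exists Y (a : T -> option A) (U : T -> R) (d : R),
  [/\ 0 < d, forall s, 0 <= U s <= 1,
      forall s, s \in Y -> exists m, [/\ a s = Some m, safe X s m &
        expectation (fun t => if B t then 0 else U t) s m <= U s - d] &
      forall s m t, s \notin Y -> safe X s m -> 0 < p s m t -> ~~ B t && (t \notin Y)].
  apply: (H #|T| finset.set0 (fun=> None) (fun=> 1) 1 1); first exact: max_card.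
  by split; rewrite ?ltr01 ?lexx ?ler01// => s; rewrite ?inE ?lexx ?ler01.
elim: n Y a U d th => [|n IH] Y a U d th Yn [d0 /andP[th0 th1] U01 UY UP].
  exists Y, a, U, d; split=> // s m t sY; move: Yn; rewrite leqn0 cards_eq0 => /eqP Y0.
  have : s \in ~: Y by rewrite inE.
  by rewrite Y0 inE.
case: (pselect (forall s m t, s \notin Y -> safe X s m -> 0 < p s m t ->
  ~~ B t && (t \notin Y))) => [clos|]; first by exists Y, a, U, d.
move=> /existsNP[s0 /existsNP[m0 /existsNP[t0 /not_implyP[s0Y
  /not_implyP[sm0 /not_implyP[pt0 /negP]]]]]].
rewrite negb_and !negbK => Bt0.
(* The successor [t0] makes the expectation at [s0] at most [1 - e * th]. Half of this margin is
   used for the value [1 - eta] of [s0], the other half for its drop. *)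
pose eta := e * th / 2; have eth0 : 0 < e * th by rewrite mulr_gt0.
have eta0 : 0 < eta by rewrite divr_gt0.
have eth1 : e * th <= 1 by apply: mulr_ile1 => //; exact: ltW.
have etaE : eta + eta = e * th by rewrite /eta; lra.
pose U' s := if s == s0 then 1 - eta else U s.
have U'U s : s != s0 -> U' s = U s by rewrite /U' => /negbTE ->.
have U's s : 0 <= U' s <= 1.
  by rewrite /U'; case: ifP => // _; apply/andP; split; lra.
have U'le s : U' s <= 1 by case/andP: (U's s).
have YU s : s \in Y -> U' s = U s.
  by move=> sY; rewrite U'U//; apply: contraTneq sY => ->.
have sub (x y : R) : Num.min x y <= x /\ Num.min x y <= y by rewrite !ge_min !lexx ?orbT.
apply: (IH (s0 |: Y)%SET (fun s => if s == s0 then Some m0 else a s) U'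
  (Num.min d eta) (Num.min th eta)).
- rewrite -ltnS; apply: leq_trans Yn; apply: fintype.proper_card.
  apply/properP; split; first by rewrite finset.setCS finset.subsetUr.
  by exists s0; rewrite !inE ?eqxx.
- split=> //.
  + by rewrite lt_min d0.
  + by rewrite lt_min th0 eta0/= ge_min th1.
  + move=> s; rewrite !inE; case: (eqVneq s s0) => [->|ss0]/=.
      by rewrite /U' eqxx; split=> // _; have [] := sub th eta; lra.
    rewrite U'U//; have [UY1 UY2] := UY s; split=> // /UY1.
    by have [] := sub th eta; lra.
  move=> s; rewrite !inE; case: (eqVneq s s0) => [->|ss0]/= sY.
    exists m0; split=> //; have av0 : av s0 m0 by case/andP: sm0.
    rewrite [X in _ <= X - _]/U' eqxx; apply: (@le_trans _ _ (1 - e * th)).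
      apply: (expectation_gap av0 (t0 := t0)) => //; first exact: eP.
      - exact: ltW.
      - by move=> t; case: ifP.
      - case: ifP => [|/negbT Bt]; first by rewrite subr_ge0.
        by case/orP: Bt0 => [|t0Y]; [rewrite (negbTE Bt)|rewrite YU//; exact: (UY t0).1].
    by have [] := sub d eta; lra.
  have [m [am sm exm]] := UP s sY; exists m; split=> //.
  rewrite U'U//; apply: (@le_trans _ _ (U s - d)); last by have [] := sub d eta; lra.
  apply: le_trans exm; apply: le_expectation; first by case/andP: sm.
  move=> t _; case: ifP => // _; rewrite /U'; case: eqP => [->|//].
  by rewrite (UY s0).2// lerBlDr lerDl ltW.
Qed.


(* On [X] the choice [a] never leaves [X] and keeps the potential [U]
   decreasing until [B] is hit; outside [X] every action decreases the
   potential [V] in expectation at each visit to [B]. *)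
Lemma buchi_region : exists X (a : T -> option A) (U V : T -> R) (d : R),
  [/\ 0 < d, (forall s, 0 <= U s <= 1) /\ (forall s, 0 <= V s <= 1),
      forall s, s \in X -> V s = 1,
      forall s, s \in X -> exists m, [/\ a s = Some m, safe X s m &
        expectation (fun t => if B t then 0 else U t) s m <= U s - d] &
      forall s m, s \notin X -> av s m -> expectation V s m <= V s - d * (B s)%:R].
Proof.
have [e [e0 e1 eP]] := min_prob.
(* [X] shrinks to [X :&: Y] in each round until the attractor [Y] covers it; [th] keeps [V] away
   from 1 outside [X]. *)
suff H n X (V : T -> R) (d th : R) : (#|X| <= n)%N ->
  [/\ 0 < d, 0 < th <= 1,
    forall s, 0 <= V s <= 1 /\ ((s \notin X) -> V s <= 1 - th),
    forall s, s \in X -> V s = 1 &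
    forall s m, s \notin X -> av s m -> expectation V s m <= V s - d * (B s)%:R] ->
  exists X (a : T -> option A) (U V : T -> R) (d : R),
  [/\ 0 < d, (forall s, 0 <= U s <= 1) /\ (forall s, 0 <= V s <= 1),
      forall s, s \in X -> V s = 1,
      forall s, s \in X -> exists m, [/\ a s = Some m, safe X s m &
        expectation (fun t => if B t then 0 else U t) s m <= U s - d] &
      forall s m, s \notin X -> av s m -> expectation V s m <= V s - d * (B s)%:R].
  apply: (H #|T| [set: T]%SET (fun=> 1) 1 1); first exact: max_card.
  by split; rewrite ?ltr01 ?lexx ?ler01// => s; rewrite ?inE// ?lexx ler01.
have min_le (x y : R) : Num.min x y <= x /\ Num.min x y <= y.
  by rewrite !ge_min !lexx ?orbT.
elim: n X V d th => [|n IH] X V d th Xn [d0 /andP[th0 th1] V01 VX VP];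
  have [Y [a [U [dU [dU0 U01 UY clos]]]]] := attractor_potential X.
  exists X, a, U, V, d; split=> //; first by split=> // s; exact: (V01 s).1.
  by move=> s sX; move: Xn; rewrite leqn0 cards_eq0 => /eqP X0; rewrite X0 inE in sX.
have [XY|XY] := boolP (X \subset Y).
  have [m1 m2] := min_le d dU.
  exists X, a, U, V, (Num.min d dU); split=> //.
  - by rewrite lt_min d0.
  - by split=> // s; exact: (V01 s).1.
  - move=> s /(fintype.subsetP XY)/UY[m [am sm Um]]; exists m; split=> //.
    by apply: le_trans Um _; lra.
  - move=> s m sX sm; apply: le_trans (VP s m sX sm) _.
    by rewrite lerD2l lerN2; apply: ler_wpM2r.
pose eta := e * th; have eta0 : 0 < eta by rewrite mulr_gt0.
have eta1 : eta <= 1 by apply: mulr_ile1 => //; exact: ltW.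
pose d' := Num.min d (eta / 2).
have [d'd d'eta] := min_le d (eta / 2); rewrite -/d' in d'd d'eta.
have d'0 : 0 < d' by rewrite lt_min d0 divr_gt0.
pose th' := Num.min th (eta / 2).
have [th'th th'eta] := min_le th (eta / 2); rewrite -/th' in th'th th'eta.
have th'0 : 0 < th' by rewrite lt_min th0 divr_gt0.
have Bd s : 0 <= d' * (B s)%:R /\ d' * (B s)%:R <= eta / 2.
  by case: (B s); rewrite ?mulr1 ?mulr0; split; lra.
(* A removed state gets [1 - eta], plus [d'] if it is in [B], to pay for that visit. A safe action
   leads only to removed states outside [B], of value exactly [1 - eta]; any other leaves [X] with
   probability at least [e], so its expectation is at most [1 - e * th]. As [d'] is at most
   [eta / 2], a gap of [eta / 2] below 1 remains. *)
pose V' s := if s \in X :&: Y then 1 else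
  if s \in X then 1 - eta + d' * (B s)%:R else V s.
have V'V s : V' s <= V s.
  rewrite /V' inE; case: ifP => [/andP[sX _]|_]; first by rewrite VX.
  by case: ifP => // sX; rewrite VX//; have [] := Bd s; lra.
have V'1 s : V' s <= 1 by apply: le_trans (V'V s) _; case/andP: (V01 s).1.
apply: (IH (X :&: Y)%SET V' d' th').
- rewrite -ltnS; apply: leq_trans Xn; apply: fintype.proper_card.
  by rewrite finset.properEneq finset.subsetIl andbT; apply: contraNneq XY => <-; exact: finset.subsetIr.
- split; first by [].
  + by rewrite th'0 (le_trans th'th).
  + move=> s; split; first rewrite V'1 andbT.
      rewrite /V'; case: ifP => // _; case: ifP => _; last by case/andP: (V01 s).1.
      by have [] := Bd s; lra.
    rewrite /V' => /negbTE ->; case: ifP => [_|/negbT sX]; last by have := (V01 s).2 sX; lra.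
    by have [] := Bd s; lra.
  + by move=> s sXY; rewrite /V' sXY.
  move=> s m sXY sm; have [sX|sX] := boolP (s \in X); last first.
    apply: le_trans (_ : expectation V s m <= _); first exact: le_expectation.
    rewrite [V' s]/V' (negbTE sXY) (negbTE sX); apply: le_trans (VP s m sX sm) _.
    by rewrite lerD2l lerN2; apply: ler_wpM2r.
  have sY : s \notin Y by apply: contraNN sXY; rewrite inE sX.
  rewrite [X in _ <= X - _]/V' (negbTE sXY) sX addrK.
  have [saf|] := boolP (safe X s m).
    rewrite -(expectation_const (1 - eta) sm); apply: le_expectation => // t pt.
    have /andP[/negbTE Bt /negbTE tY] := clos s m t sY saf pt.
    have /forallP/(_ t)/implyP/(_ pt) tX := (andP saf).2.
    by rewrite /V' inE tX tY Bt/= mulr0 addr0.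
  rewrite /safe sm/= negb_forall => /existsP[t]; rewrite negb_imply => /andP[pt tX].
  apply: (expectation_gap sm (t0 := t)) => //; first exact: eP.
  - exact: ltW.
  - by apply: le_trans (V'V t) _; exact: (V01 t).2.
Qed.

End BuchiRegion.

(** * Value iteration for bounded reachability *)

Section ReachValue.
Variables (R : realType) (T A : finType) (av : T -> A -> bool) (p : T -> A -> T -> R).
Hypothesis pwf : forall s m, av s m -> (forall t, 0 <= p s m t) /\ \sum_t p s m t = 1.
Variable X : {set T}.
Implicit Types (s : T) (m : A) (V : T -> R).

Definition best_action V s : option A :=
  [pick m | av s m && [forall m', av s m' ==> (expectation p V s m' <= expectation p V s m)]].

(** The Bellman recursion for the largest probability of reaching [X] within [k] steps; a dead end
    outside [X] has value 0. *)
Fixpoint reach_value k s : R :=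
  if s \in X then 1 else
  if k is k'.+1 then
    if best_action (reach_value k') s is Some m
    then expectation p (reach_value k') s m else 0
  else 0.

Lemma best_action_avail V s m : best_action V s = Some m -> av s m.
Proof. by rewrite /best_action; case: pickP => // m' /andP[? _] [<-]. Qed.

Lemma best_actionP V s m : av s m -> exists2 m', best_action V s = Some m' &
  expectation p V s m <= expectation p V s m'.
Proof.
move=> sm; rewrite /best_action; case: pickP => [m' /andP[_ /forallP/(_ m)]|none].
  by rewrite sm => ?; exists m'.
have [m' sm' m'P] := arg_maxP (expectation p V s) sm.
have /negP[] := none m'; rewrite sm'; apply/forallP => i; apply/implyP => si.
exact: m'P.
Qed.

Lemma reach_value_in k s : s \in X -> reach_value k s = 1.
Proof. by case: k => [|k] /= ->. Qed.

Lemma reach_value_step k s m : s \notin X -> av s m ->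
  expectation p (reach_value k) s m <= reach_value k.+1 s.
Proof.
by move=> /= /negbTE -> /(best_actionP (reach_value k))[m' -> ].
Qed.

Lemma reach_value_bounds k s : 0 <= reach_value k s <= 1.
Proof.
elim: k s => [|k IH] s /=; case: ifP; rewrite ?lexx ?ler01// => _.
case E : (best_action _ s) => [m|]; last by rewrite lexx ler01.
have sm := best_action_avail E; have [p0 p1] := pwf sm; apply/andP; split.
  by apply: sumr_ge0 => t _; rewrite mulr_ge0//; case/andP: (IH t).
rewrite -[leRHS](expectation_const pwf 1 sm).
by apply: (le_expectation pwf sm) => t _; case/andP: (IH t).
Qed.

End ReachValue.

(** * Supermartingale estimates along a strategy *)

Section Drift.
Variables (R : realType) (Sigma : finType) (M : MDP R Sigma).
Variables (mu : strategy M) (s0 : mdp_st M).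
Local Notation X := (mdp_st M * mdp_act M)%type.
Local Notation c := (cyl_prob mu s0).
Hypotheses (Mwf : mdp_wf M) (muwf : strategy_wf mu).
Variables (V cost : history M -> mdp_st M -> R).
Hypothesis V_ge0 : forall h s, 0 <= V h s.

(** The letter [x] includes the action taken at time [t], so runs stuck in a dead end by then
    contribute nothing. *)
Definition expected (F : history M -> mdp_st M -> R) t :=
  \sum_(h <- words _ t) \sum_x c (rcons h x) * F h x.1.

(** The supermartingale inequality telescoped over time: every cost is paid out of the initial
    potential. *)
Lemma drift T : (forall h s m, (size h < T)%N -> mdp_avail M s m ->
    expectation (mdp_trans M) (V (rcons h (s, m))) s m <= V h s - cost h s) ->
  \sum_(0 <= t < T) expected cost t + expected V T <= V [::] s0.
Proof.
move=> dec; suff H t : (t <= T)%N ->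
    \sum_(0 <= i < t) expected cost i + expected V t <= V [::] s0 by exact: H.
elim: t => [_|t IH tT].
  rewrite big_nil add0r /expected big_seq1.
  exact: (@cyl_prob_init _ _ _ _ s0 muwf (V [::]) (V_ge0 [::] s0)).
apply: le_trans (IH (ltnW tT)); rewrite big_nat_recr//= -addrA lerD2l.
rewrite -lerBrDl /expected sum_wordsS -sumrB big_seq [leRHS]big_seq.
apply: ler_sum => h; rewrite mem_words => /eqP ht.
rewrite -sumrB; apply: ler_sum => x _; rewrite -mulrBr.
have [xa|xa] := boolP (mdp_avail M x.1 x.2); last first.
  rewrite cyl_prob_unavailable// mul0r big1// => y _.
  by rewrite cyl_prob_rcons cyl_prob_unavailable// !mul0r.
rewrite sum_letters.
apply: (@le_trans _ _ (c (rcons h x) * expectation (mdp_trans M) (V (rcons h x)) x.1 x.2)).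
  rewrite /expectation mulr_sumr; apply: ler_sum => s _.
  by rewrite /= -mulr_suml mulrA; apply: ler_wpM2r => //; exact: cyl_prob_step.
apply: ler_wpM2l; first exact: cyl_prob_ge0.
by case: x xa => s m sm; apply: dec; rewrite ?ht.
Qed.

End Drift.

Section DriftMeasure.
Variables (R : realType) (Sigma : finType) (M : MDP R Sigma).
Variables (mu : strategy M) (s0 : mdp_st M).
Hypotheses (Mwf : mdp_wf M) (muwf : strategy_wf mu).
Variable P : {measure set (runSpace M) -> \bar R}.
Hypothesis Pind : induced_measure mu s0 P.

(** Reads a nonempty word as [rcons h x] and tests [h] with the state of [x], so the state at time
    [t] is examined by [ev t.+1]. *)
Definition at_last (A : history M -> mdp_st M -> bool) : pred (history M) :=
  fun k => if k is x :: _ then A (take (size k).-1 k) (last x k).1 else false.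

Lemma at_last_rcons A h x : at_last A (rcons h x) = A h x.1.
Proof.
have : at_last A (rcons h x) = A (take (size h) (rcons h x)) (last x (rcons h x)).1.
  by case: h => [|y h] //=; rewrite size_rcons !last_rcons.
by rewrite last_rcons -cats1 take_size_cat.
Qed.

Lemma measure_at_last A t :
  P (ev t.+1 (at_last A)) = (expected mu s0 (fun h s => (A h s)%:R) t)%:E.
Proof.
rewrite (measure_ev _ Pind.1)// /expected big_mkcond sum_wordsS; congr _%:E.
apply: eq_bigr => h _; apply: eq_bigr => x _; rewrite at_last_rcons.
by case: (A h x.1); rewrite ?mulr1 ?mulr0.
Qed.

(** Each visit costs [d], so the visit probabilities sum to at most [V [::] s0 / d], and the
    Borel-Cantelli lemma applies. *)
Lemma drift_null (A : history M -> mdp_st M -> bool) V (d : R) :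
  0 < d -> (forall h s, 0 <= V h s) ->
  (forall h s m, mdp_avail M s m ->
    expectation (mdp_trans M) (V (rcons h (s, m))) s m <= V h s - d * (A h s)%:R) ->
  P (lim_sup_set (fun n => ev n (at_last A))) = 0%E.
Proof.
move=> d0 V0 dec; apply: lim_sup_set_cvg0; first by move=> n; exact: measurable_ev.
apply: (@le_lt_trans _ _ (V [::] s0 / d)%:E); last exact: ltry.
apply: lime_le; first by apply: is_cvg_nneseries => n _ _; exact: measure_ge0.
apply: nearW => -[|n]; first by rewrite big_nil lee_fin divr_ge0// ltW.
rewrite big_nat_recl//= (_ : ev 0 _ = set0); last first.
  by rewrite -subset0 => w [[|//] _ [_ ]].
rewrite measure0 add0e; under eq_bigr do rewrite measure_at_last.
rewrite sumEFin lee_fin ler_pdivlMr// mulr_suml.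
have := @drift _ _ _ mu s0 Mwf muwf V (fun h s => d * (A h s)%:R) V0 n
  (fun h s m _ => dec h s m).
apply: le_trans; rewrite -[leLHS]addr0 lerD//.
  apply: ler_sum => t _; rewrite /expected mulr_suml; apply: ler_sum => h _.
  by rewrite mulr_suml; apply: ler_sum => x _; rewrite -mulrA [_%:R * d]mulrC.
apply: sumr_ge0 => h _; apply: sumr_ge0 => x _.
by rewrite mulr_ge0// cyl_prob_ge0.
Qed.

(** Markov's inequality at time [n], the expected potential never having increased. *)
Lemma drift_bound (A : history M -> mdp_st M -> bool) V n : (forall h s, 0 <= V h s) ->
  (forall h s m, (size h < n)%N -> mdp_avail M s m ->
    expectation (mdp_trans M) (V (rcons h (s, m))) s m <= V h s) ->
  (forall h s, size h = n -> A h s -> 1 <= V h s) ->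
  (P (ev n.+1 (at_last A)) <= (V [::] s0)%:E)%E.
Proof.
move=> V0 dec AV; rewrite measure_at_last lee_fin.
have dec' h s m : (size h < n)%N -> mdp_avail M s m ->
    expectation (mdp_trans M) (V (rcons h (s, m))) s m <= V h s - (fun _ _ => 0) h s.
  by move=> ? ?; rewrite subr0; exact: dec.
apply: le_trans (drift s0 Mwf muwf V0 dec').
rewrite -[leLHS]add0r lerD//.
  apply: sumr_ge0 => t _; apply: sumr_ge0 => h _; apply: sumr_ge0 => x _.
  by rewrite mulr0.
rewrite /expected big_seq [leRHS]big_seq; apply: ler_sum => h.
rewrite mem_words => /eqP hn; apply: ler_sum => x _.
apply: ler_wpM2l; first exact: cyl_prob_ge0.
by case E : (A h x.1) => //; exact: AV.
Qed.

End DriftMeasure.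
(** * Products and finite-memory chains *)

Section FiniteMeasure.
Variables (R : realType) (Sigma : finType) (M : MDP R Sigma).
Variable P : {measure set (runSpace M) -> \bar R}.
Implicit Types (A B : set (runSpace M)) (F : nat -> set (runSpace M)).

Lemma measure_mono A B : measurable A -> measurable B -> A `<=` B -> (P A <= P B)%E.
Proof. by move=> mA mB AB; apply: le_measure; rewrite ?inE. Qed.

Lemma measure_leU A B C : measurable A -> measurable B -> measurable C ->
  A `<=` B `|` C -> (P A <= P B + P C)%E.
Proof.
move=> mA mB mC ABC; apply: (le_trans (measure_mono mA (measurableU _ _ mB mC) ABC)).
exact: measureU2.
Qed.

Lemma measure_le_null A B C : measurable A -> measurable B -> measurable C ->
  P C = 0%E -> A `<=` B `|` C -> (P A <= P B)%E.
Proof.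
by move=> mA mB mC C0 /(measure_leU mA mB mC); rewrite C0 adde0.
Qed.

Lemma measure_bigcup0 F : (forall n, measurable (F n)) ->
  (forall n, P (F n) = 0%E) -> P (\bigcup_n F n) = 0%E.
Proof.
move=> mF F0; apply/eqP; rewrite eq_le measure_ge0 andbT.
apply: (le_trans (generalized_Boole_inequality P mF _)).
  exact: bigcupT_measurable.
by rewrite eseries0// => n _ _; rewrite F0.
Qed.

Lemma measure_bigcup_approx F (e : R) : (P setT < +oo)%E ->
  (forall n, measurable (F n)) -> {homo F : n m / (n <= m)%N >-> n `<=` m} ->
  0 < e -> exists n, (P (\bigcup_n F n) <= P (F n) + e%:E)%E.
Proof.
move=> Pf mF ndF e0; have mU : measurable (\bigcup_n F n) by exact: bigcupT_measurable.
have cv : P \o F @ \oo --> P (\bigcup_n F n).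
  by apply: nondecreasing_cvg_mu => // n m nm; apply/subsetPset/ndF.
apply: contrapT => /forallNP H.
have : (limn (P \o F) <= P (\bigcup_n F n) - e%:E)%E.
  apply: lime_le; first exact: cvgP cv.
  apply: nearW => n /=; have /negP := H n; rewrite -ltNge => /ltW.
  by rewrite EFinN leeBrDr.
rewrite (cvg_lim _ cv)// leNgt => /negP; apply.
have := fin_num_finite_measure Pf mU; case: (P _) => // r _.
by rewrite -EFinB lte_fin gtrBl.
Qed.

End FiniteMeasure.

Section Support.
Variables (R : realType) (Sigma : finType) (M : MDP R Sigma).
Variables (mu : strategy M) (s0 : mdp_st M).
Hypotheses (Mwf : mdp_wf M) (muwf : strategy_wf mu).

(** A null set outside which every action of an infinite run is available and every transition has
    positive probability; this allows arguments run by run. *)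
Definition unlikely : set (runSpace M) :=
  \bigcup_n ev n.+1 (fun h => cyl_prob mu s0 h == 0).

Lemma measurable_unlikely : measurable unlikely.
Proof. by apply: bigcupT_measurable => n; exact: measurable_ev. Qed.

Lemma unlikely0 (P : {measure set (runSpace M) -> \bar R}) :
  induced_measure mu s0 P -> P unlikely = 0%E.
Proof.
move=> [Pc _]; apply: measure_bigcup0 => n; first exact: measurable_ev.
by rewrite (measure_ev _ Pc)// big1// => h /eqP.
Qed.

Lemma likely_run (w : runSpace M) r : run_states w r -> ~ unlikely w ->
  (r 0%N).1 = s0 /\ forall n, mdp_avail M (r n).1 (r n).2 /\
    0 < mdp_trans M (r n).1 (r n).2 (r n.+1).1.
Proof.
move=> wr lw; have c0 n : cyl_prob mu s0 (mkseq r n.+1) != 0.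
  by apply/negP => c0; apply: lw; exists n => //; apply/(ev_run _ _ wr).
split=> [|n].
  have := c0 0%N; rewrite [mkseq _ _]/= cyl_prob1 mulf_eq0 negb_or pnatr_eq0.
  by rewrite eqb0 negbK => /andP[/eqP].
have avn : mdp_avail M (r n).1 (r n).2.
  apply: contraNT (c0 n) => rN; rewrite mkseqS.
  by apply/eqP; exact: cyl_prob_unavailable.
split=> //; have := c0 n.+1; rewrite !mkseqS cyl_prob_rcons !mulf_eq0 !negb_or.
by case/and3P => _ t0 _; rewrite lt_neqAle eq_sym t0 (Mwf avn).1.
Qed.

Lemma induced_measure_unique (P1 P2 : {measure set (runSpace M) -> \bar R}) E :
  induced_measure mu s0 P1 -> induced_measure mu s0 P2 -> measurable E ->
  E `<=` infinite_runs M -> (P1 E <= P2 E)%E.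
Proof.
move=> i1 i2 mE Einf; apply: measure_cyl_dom => //.
- exact: le_lt_trans (induced_le1 muwf i1) (ltry _).
- exact: le_lt_trans (induced_le1 muwf i2) (ltry _).
- by move=> k k0; rewrite i1.1// i2.1.
Qed.

End Support.

Section Product.
Variables (R : realType) (Sigma : finType) (M : MDP R Sigma) (N : NBW Sigma).
Hypothesis Mwf : mdp_wf M.
Local Notation MN := (prod_MDP M N).

Lemma prod_wf : mdp_wf MN.
Proof.
move=> [s q] [m q'] /= /andP[sm _]; have [p0 p1] := Mwf sm; split.
  by move=> [s' q'']; case: ifP.
rewrite -p1 (eq_bigr (fun x : mdp_st M * nbw_state N =>
  (fun s' q'' => if q'' == q' then mdp_trans M s m s' else 0) x.1 x.2)) => [|[]//].
rewrite -(pair_bigA _ (fun s' q'' => if q'' == q' then mdp_trans M s m s' else 0))/=.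
by apply: eq_bigr => s' _; rewrite -big_mkcond big_pred1_eq.
Qed.

Definition final_product (_ : history MN) (sq : mdp_st M * nbw_state N) :=
  sq.2 \in nbw_final N.

Lemma syn_eventE : syn_event M N =
  lim_sup_set (fun n => ev n (at_last final_product)).
Proof.
have at_run (w : runSpace MN) r n : run_states w r ->
    ev n.+1 (at_last final_product) w <->
    (r n).1.2 \in nbw_final N.
  by move=> wr; rewrite (ev_run _ _ wr) mkseqS at_last_rcons.
apply/seteqP; split=> w.
  move=> [r [wr inf]] n _; have [m nm mF] := inf n.
  by exists m.+1; [exact: leqW|apply/(at_run _ _ _ wr)].
move=> winf; have /infinite_runsP[r wr] := lim_sup_ev_infinite winf.
exists r; split=> // n; have [[//|m] nm /(at_run _ _ _ wr) mF] := winf n.+1 I.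
by exists m.
Qed.

Lemma measurable_syn_event : measurable (syn_event M N).
Proof. by rewrite syn_eventE; exact: measurable_buchi. Qed.

Lemma syn_event_infinite : syn_event M N `<=` infinite_runs MN.
Proof. by rewrite syn_eventE; exact: lim_sup_ev_infinite. Qed.

Definition prod_proj := simmap (M1 := MN) (M2 := M) fst (fun x => Some x.2.1).

(** A product action announces the next automaton state, and any other successor has probability 0.
    Off the null set the automaton components thus form a run of [N] on the labels. *)
Lemma syn_event_proj (tau : strategy MN) (s0 : mdp_st M) (w : runSpace MN) :
  strategy_wf tau -> syn_event M N w -> ~ unlikely tau (s0, nbw_init N) w ->
  sem_event M N (pathmap prod_proj w).
Proof.
move=> tauwf [r [wr inf]] /(likely_run prod_wf tauwf wr)[r0 rP].
exists (fun n => ((r n).1.1, (r n).2.1)); split.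
  by move=> n; rewrite /pathmap wr.
exists (fun n => (r n).1.2); split=> //.
split=> [|i]; first by rewrite r0.
have [/andP[_ d] /=] := rP i.
by case: eqP => [->|_]; rewrite ?ltxx.
Qed.

Lemma prod_simulation (tau : strategy MN) (s0 : mdp_st M)
    (P : {measure set (runSpace MN) -> \bar R}) :
  strategy_wf tau -> induced_measure tau (s0, nbw_init N) P ->
  exists2 nu : strategy M, strategy_wf nu &
  exists2 P2 : {measure set (runSpace M) -> \bar R}, induced_measure nu s0 P2 &
    forall E, measurable E -> E `<=` infinite_runs M ->
      (P (pathmap prod_proj @^-1` E) <= P2 E)%E.
Proof.
move=> tauwf Pi; apply: (simulation prod_wf Mwf _ _ tauwf Pi).
  by move=> [[s q] [m q']] _ /= /andP[sm _] [<-].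
move=> [[s q] [m q']] _ s' /= /andP[sm _] [<-].
rewrite (eq_bigr (fun x : mdp_st M * nbw_state N =>
  (fun s' q'' => if q'' == q' then mdp_trans M s m s' else 0) x.1 x.2)) => [|[]//].
rewrite big_mkcond -(pair_bigA _ (fun t q'' => if t == s' then
  (if q'' == q' then mdp_trans M s m t else 0) else 0))/=.
rewrite (bigD1 s')//= eqxx -big_mkcond big_pred1_eq big1 ?addr0// => t /negbTE ->.
by rewrite big1.
Qed.

Lemma PSyn_le_PSem s0 : (PSyn M N s0 <= PSem M N s0)%E.
Proof.
apply: ge_ereal_sup => _ [P [tau [tauwf Pi]] <-].
have [nu nuwf [P2 P2i dom]] := prod_simulation tauwf Pi.
have mpre : measurable (pathmap prod_proj @^-1` sem_event M N).
  by apply: measurable_preimage_pathmap; exact: measurable_sem_event.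
have msyn := measurable_syn_event; have mu := measurable_unlikely tau (s0, nbw_init N).
apply: (@le_trans _ _ (P (pathmap prod_proj @^-1` sem_event M N))).
  apply: (measure_le_null msyn mpre mu (unlikely0 Pi)) => w ws.
  case: (pselect (unlikely tau (s0, nbw_init N) w)) => [uw|lw]; first by right.
  by left; exact: syn_event_proj tauwf ws lw.
apply: (le_trans (dom _ (@measurable_sem_event _ _ M N) (@sem_event_infinite _ _ M N))).
by apply: ereal_sup_ubound; exists P2 => //; exists nu.
Qed.

End Product.

(** * Markov chains of finite-memory strategies, and forgetting the memory *)

Section FiniteMemoryChain.
Variables (R : realType) (Sigma : finType) (M : MDP R Sigma) (Y : finType).
Variables (upd : mdp_st M -> Y -> Y) (ch : mdp_st M -> Y -> option (mdp_act M)).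
Hypothesis Mwf : mdp_wf M.
Hypothesis ch_avail : forall s y m, ch s y = Some m -> mdp_avail M s m.

(* The chain obtained from [M] by playing [ch]; the action [None] is a self-loop
   taken where [ch] selects nothing, in particular at the dead ends of [M]. *)
Definition memory_chain : MDP R Sigma := {|
  mdp_st := (mdp_st M * Y)%type;
  mdp_act := option (mdp_act M);
  mdp_avail := fun t mo => mo == ch t.1 t.2;
  mdp_trans := fun t mo t' => if mo is Some m
    then (if t'.2 == upd t.1 t.2 then mdp_trans M t.1 m t'.1 else 0)
    else (t' == t)%:R;
  mdp_lab := fun t => mdp_lab M t.1 |}.
Local Notation MC := memory_chain.

Lemma expectation_memory_chain (V : mdp_st MC -> R) s y m :
  expectation (mdp_trans MC) V (s, y) (Some m) =
  expectation (mdp_trans M) (fun s' => V (s', upd s y)) s m.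
Proof.
rewrite /expectation (eq_bigr (fun x : mdp_st M * Y => (fun s' y' =>
  if y' == upd s y then mdp_trans M s m s' * V (s', y') else 0) x.1 x.2)); last first.
  by move=> [s' y'] _ /=; case: ifP; rewrite ?mul0r.
rewrite -(pair_bigA _ (fun s' y' =>
  if y' == upd s y then mdp_trans M s m s' * V (s', y') else 0))/=.
by apply: eq_bigr => s' _; rewrite -big_mkcond big_pred1_eq.
Qed.

Lemma expectation_memory_chain_None (V : mdp_st MC -> R) t :
  expectation (mdp_trans MC) V t None = V t.
Proof.
rewrite /expectation (bigD1 t)//= eqxx mul1r big1 ?addr0// => i /negbTE it.
by rewrite it mul0r.
Qed.

Lemma memory_chain_wf : mdp_wf MC.
Proof.
move=> [s y] mo /= /eqP moE; split.
  case: mo moE => [m mE|_] t'; last by rewrite ler0n.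
  by case: ifP => // _; apply: (Mwf (ch_avail (esym mE))).1.
rewrite (eq_bigr (fun t => mdp_trans MC (s, y) mo t * 1)) => [|t _]; last by rewrite mulr1.
case: mo moE => [m mE|_]; last exact: (expectation_memory_chain_None (fun=> 1)).
apply: etrans (expectation_memory_chain (fun=> 1) s y m) _.
rewrite /expectation; under eq_bigr do rewrite mulr1.
exact: (Mwf (ch_avail (esym mE))).2.
Qed.

Lemma memory_chain_MC : is_MC MC.
Proof. by move=> t; exact: (card1 (ch t.1 t.2)). Qed.

Definition chain_strategy : strategy MC := fun _ t mo => (mo == ch t.1 t.2)%:R.

Lemma chain_strategy_wf : strategy_wf chain_strategy.
Proof.
split; [by move=> h s m; rewrite /chain_strategy ler0n|split].
  by move=> h s m /= /negbTE mE; rewrite /chain_strategy mE.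
move=> h s _; rewrite /chain_strategy (bigD1 (ch s.1 s.2))//= eqxx big1 ?addr0//.
by move=> m /negbTE ->.
Qed.

(** Whatever strategy a simulation returns on the chain is thereby identified, so its measure can be
    compared with the given one. *)
Lemma chain_strategy_unique (mu : strategy MC) : strategy_wf mu -> mu = chain_strategy.
Proof.
move=> [_ [mu0 mu1]]; apply/funext => h; apply/funext => t; apply/funext => mo.
rewrite /chain_strategy; case: eqP => [->|/eqP mN]; last by apply: mu0.
have <- : \sum_m mu h t m = 1 by apply: mu1; exists (ch t.1 t.2) => /=.
rewrite (bigD1 (ch t.1 t.2))//= big1 ?addr0// => m mN; exact: mu0.
Qed.

(** The self-loops leave no dead ends, so no mass is lost and complements can be taken later. *)
Lemma chain_total t0 n : \sum_(h <- words _ n.+1) cyl_prob chain_strategy t0 h = 1.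
Proof.
have [_ [_ mu1]] := chain_strategy_wf.
elim: n => [|n IH].
  rewrite sum_wordsS big_seq1 sum_letters (bigD1 t0)//= [X in _ + X]big1 => [|t tN].
    rewrite addr0; under eq_bigr do rewrite eqxx mul1r mulr1.
    by apply: mu1; exists (ch t0.1 t0.2) => /=.
  by rewrite big1// => mo _; rewrite (negbTE tN) mul0r.
rewrite sum_wordsS -IH big_seq [RHS]big_seq; apply: eq_bigr => h.
rewrite mem_words; case/lastP: h => // h x _; rewrite sum_letters.
have [xa|xa] := boolP (mdp_avail MC x.1 x.2); last first.
  rewrite [RHS]cyl_prob_unavailable//; last exact: chain_strategy_wf.
  rewrite big1// => t _; rewrite big1// => mo _; rewrite cyl_prob_rcons.
  by rewrite cyl_prob_unavailable ?mul0r//; exact: chain_strategy_wf.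
rewrite -[RHS]mulr1 -(memory_chain_wf xa).2 mulr_sumr; apply: eq_bigr => t _.
under eq_bigr do rewrite cyl_prob_rcons /= mulrA.
rewrite -mulr_sumr mu1 ?mulr1//.
by exists (ch t.1 t.2) => /=.
Qed.

Definition never_stuck : set (runSpace MC) :=
  \bigcap_n @ev _ _ MC n (all (fun x : mdp_st M * Y * option (mdp_act M) => x.2 != None)).

Lemma measurable_never_stuck : measurable never_stuck.
Proof. by apply: bigcapT_measurable => n; exact: measurable_ev. Qed.

Lemma never_stuckP (w : runSpace MC) r : run_states w r ->
  never_stuck w <-> forall n, (r n).2 != None.
Proof.
move=> wr; split=> [ns n|ns n _].
  have := ns n.+1 I; rewrite (ev_run _ _ wr) mkseqS all_rcons.
  by case/andP.
by apply/(ev_run _ _ wr)/allP => x /mapP[i _ ->]; exact: ns.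
Qed.

Variable N : NBW Sigma.
Local Notation MN := (prod_MDP M N).
Local Notation CN := (prod_MDP MC N).

Definition forget_memory : mdp_st CN * mdp_act CN -> option (mdp_st MN * mdp_act MN) :=
  simmap (M1 := CN) (M2 := MN) (fun t => (t.1.1, t.2))
    (fun x => omap (fun m => (m, x.2.2)) x.2.1).

Lemma forget_memory_simulation (tau : strategy CN) (t0 : mdp_st CN)
    (P : {measure set (runSpace CN) -> \bar R}) :
  strategy_wf tau -> induced_measure tau t0 P ->
  exists2 nu : strategy MN, strategy_wf nu &
  exists2 P2 : {measure set (runSpace MN) -> \bar R},
    induced_measure nu ((t0.1.1, t0.2) : mdp_st MN) P2 &
    forall E, measurable E -> E `<=` infinite_runs MN ->
      (P (pathmap forget_memory @^-1` E) <= P2 E)%E.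
Proof.
move=> tauwf Pi.
apply: (simulation (prod_wf memory_chain_wf) (prod_wf Mwf) _ _ tauwf Pi).
  move=> [[[s y] q] [[m|] q']] mq //= /andP[/eqP mE qq'] [<-] /=.
  by rewrite (ch_avail (esym mE)).
move=> [[[s y] q] [[m|] q']] _ [s' q''] //= _ [<-] /=.
rewrite (eq_bigl (fun x : mdp_st M * Y * nbw_state N => (x.1.1 == s') && (x.2 == q''))); last first.
  by move=> x; rewrite xpair_eqE.
rewrite (eq_bigr (fun x : mdp_st M * Y * nbw_state N => (fun t r => if r == q' then
  (if t.2 == upd s y then mdp_trans M s m t.1 else 0) else 0) x.1 x.2)) => [|[]//].
rewrite -(pair_big (fun t : mdp_st M * Y => t.1 == s') (fun r => r == q'') (fun t r => if r == q' then
  (if t.2 == upd s y then mdp_trans M s m t.1 else 0) else 0))/=.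
under eq_bigr do rewrite big_pred1_eq.
case: ifP => _; last by rewrite big1.
rewrite (eq_bigr (fun t : mdp_st M * Y => (fun u z =>
  if z == upd s y then mdp_trans M s m u else 0) t.1 t.2)) => [|[]//].
rewrite (eq_bigl (fun t : mdp_st M * Y => (t.1 == s') && predT t.2)) => [|t]; last by rewrite andbT.
rewrite -(pair_big (fun u => u == s') predT (fun u z =>
  if z == upd s y then mdp_trans M s m u else 0))/=.
by rewrite big_pred1_eq -big_mkcond big_pred1_eq.
Qed.

(** Take a measure [Q] on the product of the chain whose syntactic probability exceeds
    [P (sem_event MC N) - e]. Its never stuck runs are carried to [M] x [N] by [forget_memory]; its
    stuck ones project to the chain and weigh at most the stuck part of [P]. That part also occurs
    in [P (sem_event MC N)] and cancels, being finite. *)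
Lemma sem_never_stuck_le_PSyn s0 y0 (P : {measure set (runSpace MC) -> \bar R}) :
  induced_measure chain_strategy ((s0, y0) : mdp_st MC) P ->
  PSyn MC N ((s0, y0) : mdp_st MC) = PSem MC N ((s0, y0) : mdp_st MC) ->
  (P (sem_event MC N `&` never_stuck) <= PSyn M N s0)%E.
Proof.
move=> Pi PP; apply/lee_addgt0Pr => e e0.
have Cwf := memory_chain_wf; have Swf := chain_strategy_wf.
have Pf : (P setT < +oo)%E by exact: le_lt_trans (induced_le1 Swf Pi) (ltry _).
have msem := @measurable_sem_event _ _ MC N; have mns := measurable_never_stuck.
have msn : measurable (sem_event MC N `&` never_stuck) by exact: measurableI.
have msd : measurable (sem_event MC N `\` never_stuck) by exact: measurableD.
have lt_syn : (P (sem_event MC N) - e%:E < PSyn MC N ((s0, y0) : mdp_st MC))%E.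
  apply: (@lt_le_trans _ _ (P (sem_event MC N))).
    have := fin_num_finite_measure Pf msem; case: (P _) => // x _.
    by rewrite -EFinB lte_fin gtrBl.
  by rewrite PP; apply: ereal_sup_ubound; exists P => //; exists chain_strategy.
have [_ [Q [tau [tauwf Qi]] <-] Qlt] := ereal_sup_gt lt_syn.
have [nu nuwf [P' P'i P'dom]] := prod_simulation Cwf tauwf Qi.
have [ka kawf [K Ki Kdom]] := forget_memory_simulation tauwf Qi.
rewrite (chain_strategy_unique nuwf) in P'i.
have P'P : (P' (sem_event MC N `\` never_stuck) <= P (sem_event MC N `\` never_stuck))%E.
  by apply: induced_measure_unique P'i Pi _ _ => // w [/sem_event_infinite].
have mu := measurable_unlikely tau ((s0, y0, nbw_init N) : mdp_st CN).
pose G := pathmap forget_memory @^-1` syn_event M N.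
have mG : measurable G by apply: measurable_preimage_pathmap; exact: measurable_syn_event.
pose D := pathmap (@prod_proj _ _ MC N) @^-1` (sem_event MC N `\` never_stuck).
have mD : measurable D by exact: measurable_preimage_pathmap.
have QGD : (Q (syn_event MC N) <= Q G + Q D)%E.
  apply: le_trans (measureU2 _ mG mD).
  apply: (measure_le_null _ _ mu (unlikely0 Qi)).
  - exact: measurable_syn_event.
  - exact: measurableU.
  move=> w wsyn; case: (pselect (unlikely tau ((s0, y0, nbw_init N) : mdp_st CN) w)); first by right.
  move=> lw; left; have wsem := syn_event_proj Cwf tauwf wsyn lw.
  case: (pselect (never_stuck (pathmap (@prod_proj _ _ MC N) w))) => ns; last by right.
  left; have [r [wr inf]] := wsyn.
  have pr : run_states (pathmap (@prod_proj _ _ MC N) w) (fun n => ((r n).1.1, (r n).2.1)).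
    by move=> n; rewrite /pathmap wr.
  have alive n : (r n).2.1 != None by exact: ((never_stuckP pr).1 ns n).
  have [m0 _] : exists m0, (r 0%N).2.1 = Some m0 by case: ((r 0%N).2.1) (alive 0%N) => // m; exists m.
  exists (fun n => (((r n).1.1.1, (r n).1.2), (odflt m0 (r n).2.1, (r n).2.2))); split=> //.
  move=> n; rewrite /pathmap wr/= /forget_memory /simmap/=.
  by case: ((r n).2.1) (alive n).
have Ksyn : (Q G <= K (syn_event M N))%E.
  by apply: Kdom; [exact: measurable_syn_event|exact: syn_event_infinite].
have QD : (Q D <= P (sem_event MC N `\` never_stuck))%E.
  by apply: le_trans P'P; apply: P'dom => // w [/sem_event_infinite].
have Kle : (K (syn_event M N) <= PSyn M N s0)%E.
  by apply: ereal_sup_ubound; exists K => //; exists ka.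
have Kf : (K setT < +oo)%E by exact: le_lt_trans (induced_le1 kawf Ki) (ltry _).
have PD : P (sem_event MC N) =
    (P (sem_event MC N `&` never_stuck) + P (sem_event MC N `\` never_stuck))%E.
  rewrite -measureU//.
    by rewrite -setIUr setUv setIT.
  by rewrite -subset0 => w [[_ ns] [_ nns]].
apply: le_trans (leeD Kle (lexx _)).
have := lt_le_trans Qlt (le_trans QGD (leeD Ksyn QD)); rewrite PD.
have := fin_num_finite_measure Pf msn; have := fin_num_finite_measure Pf msd.
have := fin_num_finite_measure Kf (@measurable_syn_event _ _ M N).
case: (K _) => // k _; case: (P (_ `\` _)) => // x _; case: (P _) => // z _.
rewrite -!EFinD lte_fin lee_fin; lra.
Qed.

End FiniteMemoryChain.

(** * Finite-memory approximation for deterministic Büchi conditions *)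

Section FiniteMemoryApproximation.
Variables (R : realType) (Sigma : finType) (M : MDP R Sigma).
Hypothesis Mwf : mdp_wf M.
Variables (Z : finType) (upd : Z -> Sigma -> Z) (z0 : Z) (fin : pred Z).
Local Notation T := (mdp_st M * Z)%type.
Local Notation hm := (history_memory upd z0).

Definition tracked_avail (t : T) m := mdp_avail M t.1 m.

(** The memory paired with a state has not yet read the label of that state; it reads it on leaving.
    This matches [history_memory]. *)
Definition tracked_trans (t : T) m (t' : T) : R :=
  if t'.2 == upd t.2 (mdp_lab M t.1) then mdp_trans M t.1 m t'.1 else 0.

Lemma expectation_tracked (V : T -> R) s z m :
  expectation tracked_trans V (s, z) m =
  expectation (mdp_trans M) (fun s' => V (s', upd z (mdp_lab M s))) s m.
Proof.
rewrite /expectation (eq_bigr (fun x : T => (fun s' z' =>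
  if z' == upd z (mdp_lab M s) then mdp_trans M s m s' * V (s', z') else 0) x.1 x.2)).
  rewrite -(pair_bigA _ (fun s' z' =>
    if z' == upd z (mdp_lab M s) then mdp_trans M s m s' * V (s', z') else 0))/=.
  by apply: eq_bigr => s' _; rewrite -big_mkcond big_pred1_eq.
by move=> [s' z'] _; rewrite /tracked_trans/=; case: ifP; rewrite ?mul0r.
Qed.

Lemma tracked_wf t m : tracked_avail t m ->
  (forall t', 0 <= tracked_trans t m t') /\ \sum_t' tracked_trans t m t' = 1.
Proof.
case: t => s z sm; have [p0 p1] := Mwf sm; split.
  by move=> t'; rewrite /tracked_trans; case: ifP.
have := expectation_tracked (fun=> 1) s z m; rewrite /expectation.
by under eq_bigr do rewrite mulr1; under [in RHS]eq_bigr do rewrite mulr1; rewrite p1.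
Qed.

Variables (X : {set T}) (a : T -> option (mdp_act M)) (U V : T -> R) (d : R).
Hypothesis d_gt0 : 0 < d.
Hypotheses (U01 : forall t, 0 <= U t <= 1) (V01 : forall t, 0 <= V t <= 1).
Hypothesis V_in : forall t, t \in X -> V t = 1.
Hypothesis a_in : forall t, t \in X -> exists m, [/\ a t = Some m,
  safe tracked_avail tracked_trans X t m &
  expectation tracked_trans (fun t' => if fin t'.2 then 0 else U t') t m <= U t - d].
Hypothesis V_out : forall t m, t \notin X -> tracked_avail t m ->
  expectation tracked_trans V t m <= V t - d * (fin t.2)%:R.

Local Notation value := (reach_value tracked_avail tracked_trans X).

Section Upper.
Variables (mu : strategy M) (s0 : mdp_st M).
Hypothesis muwf : strategy_wf mu.
Variable P : {measure set (runSpace M) -> \bar R}.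
Hypothesis Pind : induced_measure mu s0 P.

Definition visited_before (h : history M) : bool :=
  (foldl (fun zb x => (upd zb.1 (mdp_lab M x.1), zb.2 || ((x.1, zb.1) \in X)))
    (z0, false) h).2.

Definition visited (h : history M) (s : mdp_st M) :=
  visited_before h || ((s, hm h) \in X).

Lemma visited_before_rcons h x : visited_before (rcons h x) = visited h x.1.
Proof.
rewrite /visited_before foldl_rcons/=; congr (_ || ((_, _) \in X)).
by elim/last_ind: h => // h y IH; rewrite !foldl_rcons/= IH history_memory_rcons.
Qed.

Lemma visited_mono (w : runSpace M) r n m : run_states w r -> (n <= m)%N ->
  ev n.+1 (at_last visited) w -> ev m.+1 (at_last visited) w.
Proof.
move=> wr /subnK <-; rewrite !(ev_run _ _ wr) !mkseqS !at_last_rcons => vn.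
elim: (m - n)%N => // k IH.
by rewrite addSn /visited mkseqS visited_before_rcons IH.
Qed.

(** Freezing the potential at 1 from the first visit to [X] keeps it a supermartingale, because [V]
    is 1 on [X]; before that visit, each memory in [fin] costs [d]. *)
Lemma buchi_visited0 :
  P (lim_sup_set (fun n => ev n (at_last (fun h s => ~~ visited h s && fin (hm h))))) = 0%E.
Proof.
apply: (drift_null Mwf muwf Pind (V := fun h s => if visited h s then 1 else V (s, hm h)) d_gt0).
  by move=> h s; case: ifP => // _; case/andP: (V01 (s, hm h)).
move=> h s m sm; have step s' : (if visited (rcons h (s, m)) s' then 1 else V (s', hm (rcons h (s, m))))
    = if visited h s then 1 else V (s', upd (hm h) (mdp_lab M s)).
  rewrite {1}/visited visited_before_rcons history_memory_rcons/=.
  by case: (visited h s) => //=; case: ifP => // /V_in ->.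
rewrite (_ : (fun s' => if visited _ s' then _ else _) = fun s' =>
  if visited h s then 1 else V (s', upd (hm h) (mdp_lab M s))); last exact/funext.
case: (boolP (visited h s)) => [_|]/=.
  by rewrite (expectation_const Mwf)// mulr0 subr0.
rewrite negb_or => /andP[_ tX].
by have := V_out tX (m := m) sm; rewrite expectation_tracked.
Qed.

(** The potential is the value for the remaining steps, frozen at 1 once [X] is visited; no action
    raises it, since [reach_value] takes the best one. *)
Lemma visited_bound n : (P (ev n.+1 (at_last visited)) <= (value n (s0, z0))%:E)%E.
Proof.
have vb k t : 0 <= value k t <= 1 by exact: reach_value_bounds tracked_wf _ _ _.
pose W h s := if visited h s then 1 else value (n - size h) (s, hm h).
have -> : value n (s0, z0) = W [::] s0.
  by rewrite /W subn0; case: ifP => //=; exact: reach_value_in.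
apply: (drift_bound Mwf muwf Pind).
- by move=> h s; rewrite /W; case: ifP => // _; case/andP: (vb (n - size h)%N (s, hm h)).
- move=> h s m hn sm; have [k nk] : exists k, (n - size h)%N = k.+1.
    by exists (n - size h).-1; rewrite prednK// subn_gt0.
  have step s' : W (rcons h (s, m)) s' =
      if visited h s then 1 else value k (s', upd (hm h) (mdp_lab M s)).
    rewrite /W {1}/visited visited_before_rcons history_memory_rcons/= size_rcons.
    rewrite subnS nk/=; case: (visited h s) => //=.
    by case: ifP => // /reach_value_in ->.
  rewrite (_ : W _ = fun s' => if visited h s then 1 else
    value k (s', upd (hm h) (mdp_lab M s))); last exact/funext.
  rewrite /W; case: (boolP (visited h s)) => [_|].
    by rewrite (expectation_const Mwf).
  rewrite negb_or => /andP[_ tX]; rewrite nk.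
  by rewrite -expectation_tracked; exact: reach_value_step.
- by move=> h s _ vhs; rewrite /W vhs.
Qed.

(** Up to a null set an accepted run visits [X] at a finite time, and by continuity a deadline [n]
    costs at most [e]. *)
Lemma buchi_le_value (e : R) : 0 < e ->
  exists n, (P (buchi_event upd z0 fin) <= (value n (s0, z0) + e)%:E)%E.
Proof.
move=> e0; have Pf : (P setT < +oo)%E by exact: le_lt_trans (induced_le1 muwf Pind) (ltry _).
pose G n := buchi_event upd z0 fin `&` ev n.+1 (at_last visited).
have mB : measurable (buchi_event upd z0 fin : set (runSpace M)) by exact: measurable_buchi.
have mG n : measurable (G n) by apply: measurableI => //; exact: measurable_ev.
have ndG : {homo G : n m / (n <= m)%N >-> n `<=` m}.
  move=> n m nm w [wb wv]; split=> //.
  by have /infinite_runsP[r wr] := lim_sup_ev_infinite wb; exact: visited_mono wr nm wv.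
have [n Gn] := measure_bigcup_approx Pf mG ndG e0.
exists n; apply: (@le_trans _ _ (P (\bigcup_n G n))).
  apply: (measure_le_null mB _ _ buchi_visited0); first exact: bigcupT_measurable.
    exact: measurable_buchi.
  move=> w wb; have /infinite_runsP[r wr] := lim_sup_ev_infinite wb.
  case: (pselect (exists n, ev n.+1 (at_last visited) w)) => [[k wk]|nv].
    by left; exists k.
  right => k _; have [m km wm] := wb k I; exists m.+1; first exact: leqW.
  apply/(ev_run _ _ wr); rewrite mkseqS at_last_rcons; apply/andP; split.
    by apply/negP => vm; apply: nv; exists m; apply/(ev_run _ _ wr); rewrite mkseqS at_last_rcons.
  by move: wm => /(ev_run _ _ wr).
apply: (le_trans Gn); rewrite EFinD leeD2r//.
apply: le_trans (visited_bound n).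
by apply: measure_mono => //; [exact: measurable_ev|exact: subIsetr].
Qed.

End Upper.

Section Lower.
Variable n : nat.
Local Notation Y := (Z * 'I_n.+1)%type.

(* Before [X] is reached, the number of steps left selects the optimal action
   for the bounded reachability of [X]. *)
Definition chain_upd (s : mdp_st M) (y : Y) : Y :=
  (upd y.1 (mdp_lab M s), inord (y.2 : nat).-1).

Definition chain_choice (s : mdp_st M) (y : Y) : option (mdp_act M) :=
  if (s, y.1) \in X then a (s, y.1)
  else if nat_of_ord y.2 is k.+1
    then best_action tracked_avail tracked_trans (value k) (s, y.1)
  else None.

Lemma chain_choice_avail s y m : chain_choice s y = Some m -> mdp_avail M s m.
Proof.
rewrite /chain_choice; case: ifP => [/a_in[m' [-> /andP[sm _] _]] [<-]//|_].
by case: (nat_of_ord y.2) => // k /best_action_avail.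
Qed.

Local Notation MC := (memory_chain chain_upd chain_choice).
Local Notation chain := (chain_strategy (upd := chain_upd) (ch := chain_choice)).
Let CW : mdp_wf MC := memory_chain_wf Mwf chain_choice_avail.
Let SW : strategy_wf chain := @chain_strategy_wf _ _ _ _ _ _.

Variable s0 : mdp_st M.
Local Notation t0 := ((s0, (z0, ord_max)) : mdp_st MC).
Variable P : {measure set (runSpace MC) -> \bar R}.
Hypothesis Pind : induced_measure chain t0 P.

Local Notation tr := (fun t : mdp_st MC => (t.1, t.2.1) : T).

Definition good (t : mdp_st MC) := (tr t \in X) && ~~ fin t.2.1.

Definition good_since k (h : history MC) (t : mdp_st MC) :=
  [&& (k <= size h)%N, all (fun x => good x.1) (drop k h) & good t].

Lemma good_since_rcons k h x t : (k <= size h)%N ->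
  good_since k (rcons h x) t = good_since k h x.1 && good t.
Proof.
move=> kh; rewrite /good_since size_rcons kh (leqW kh) drop_rcons// all_rcons/=.
by rewrite [_ && all _ _]andbC -andbA.
Qed.

(** While the run stays in [X] without meeting [fin] after time [k], [U] drops by [d] in expectation
    at every step, which cannot go on for ever. The potential is 1, the upper bound of [U], before
    time [k], and 0 once the phase has ended. *)
Lemma good_since0 k : P (lim_sup_set (fun n => ev n (at_last (good_since k)))) = 0%E.
Proof.
pose W h t := if (size h < k)%N then 1 else if good_since k h t then U (tr t) else 0.
have W01 h t : 0 <= W h t <= 1.
  by rewrite /W; case: ifP => _; [rewrite ler01 lexx|case: ifP => // _; rewrite lexx ler01].
have Wlt (h : history MC) t : (size h < k)%N -> W h t = 1 by rewrite /W => ->.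
have Wge (h : history MC) t : (k <= size h)%N ->
  W h t = if good_since k h t then U (tr t) else 0 by rewrite /W ltnNge => ->.
apply: (drift_null CW SW Pind (V := W) d_gt0) => [h t|h t mo tmo].
  by case/andP: (W01 h t).
case: (ltnP (size h) k) => hk.
  rewrite Wlt// (_ : good_since _ _ _ = false); last by rewrite /good_since leqNgt hk.
  rewrite mulr0 subr0.
  rewrite -[leRHS](expectation_const CW 1 tmo).
  by apply: (le_expectation CW tmo) => t' _; case/andP: (W01 (rcons h (t, mo)) t').
have step t' : W (rcons h (t, mo)) t' =
    if good_since k h t && good t' then U (tr t') else 0.
  by rewrite Wge ?size_rcons ?good_since_rcons// leqW.
rewrite (_ : W _ = fun t' => if good_since k h t && good t' then U (tr t') else 0); last exact/funext.
rewrite Wge//; case: (boolP (good_since k h t)) => [|_]/=; last first.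
  by rewrite (expectation_const CW) ?mulr0 ?subr0.
case/and3P => _ _ /andP[tX _]; have [m [am sm Um]] := a_in tX.
move: tmo => /= /eqP; rewrite /chain_choice tX am => -> {mo step}.
case: t tX am sm Um => s [z i] /= tX am sm Um; rewrite mulr1.
rewrite (expectation_memory_chain (ch := chain_choice)).
apply: (le_trans _ Um); rewrite expectation_tracked.
apply: (le_expectation Mwf); first by case/andP: sm.
move=> s' _; rewrite /good/=; case: (fin _); rewrite ?andbF// andbT.
by case: ifP => // _; case/andP: (U01 (s', upd z (mdp_lab M s))).
Qed.

(** The complement of the value is a supermartingale, as the chain plays best actions. Where the
    counter disagrees with the elapsed time, as it does when the run is parked in a self-loop before
    time [n], the potential is 1. *)
Lemma not_reached_bound :
  (P (ev n.+1 (at_last (fun _ t => tr t \notin X))) <= (1 - value n (s0, z0))%:E)%E.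
Proof.
have vb k t : 0 <= value k t <= 1 by exact: reach_value_bounds tracked_wf _ _ _.
pose W (h : history MC) (t : mdp_st MC) :=
  if t.2.2 == (n - size h)%N :> nat then 1 - value t.2.2 (tr t) else 1.
have W01 h t : 0 <= W h t <= 1.
  by rewrite /W; have := vb t.2.2 (tr t); case: ifP => _ /andP[? ?]; apply/andP; split; lra.
have -> : 1 - value n (s0, z0) = W [::] t0 by rewrite /W /= subn0 eqxx.
apply: (drift_bound CW SW Pind) => [h t|h t mo hn tmo|h t hn tX].
- by case/andP: (W01 h t).
- have W1 : expectation (mdp_trans MC) (W (rcons h (t, mo))) t mo <= 1.
    rewrite -[leRHS](expectation_const CW 1 tmo).
    by apply: (le_expectation CW tmo) => t' _; case/andP: (W01 (rcons h (t, mo)) t').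
  rewrite [leRHS]/W; case: eqP => // kn.
  move: tmo W1 => /= /eqP; case: t kn => s [z i] /= kn.
  have [k ik] : exists k, nat_of_ord i = k.+1.
    by exists (n - size h).-1; rewrite prednK ?subn_gt0.
  have kn' : k = (n - (size h).+1)%N by rewrite subnS -kn ik.
  have kI : (k < n.+1)%N by have := ltn_ord i; rewrite ik => /ltnW.
  rewrite /chain_choice/=; case: ifP => [tX|tX].
    have [m [am /andP[sm /forallP saf] _]] := a_in tX; rewrite am => -> _.
    rewrite reach_value_in// subrr (expectation_memory_chain (ch := chain_choice)).
    rewrite -[leRHS](expectation_const Mwf 0 sm); apply: (le_expectation Mwf sm) => s' ps'.
    have := saf (s', upd z (mdp_lab M s)); rewrite /tracked_trans/= eqxx ps'/= => s'X.
    by rewrite /W size_rcons /chain_upd/= ik/= inordK// -kn' eqxx reach_value_in// subrr.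
  rewrite {1}ik; case bE : (best_action _ _ _ _) => [m|] -> W1; last first.
    by rewrite ik/= tX bE subr0.
  have sm := best_action_avail bE.
  rewrite (expectation_memory_chain (ch := chain_choice)) ik/= tX bE.
  rewrite -[X in X - _](expectation_const Mwf 1 sm) expectation_tracked.
  rewrite /expectation -sumrB; apply: ler_sum => s' _.
  rewrite /W size_rcons /chain_upd/= ik/= inordK// -kn' eqxx.
  by rewrite -mulrBr.
- rewrite /W; case: eqP => // kE; rewrite kE hn subnn/= (negbTE tX).
  by rewrite subr0.
Qed.

(** The last three sets are null. Off them, a run that is in [X] at time [n] stays there and is
    never stuck; meeting [fin] only finitely often would make it good from some time on. *)
Lemma chain_runs_cover : [set: runSpace MC] `<=`
  ev n.+1 (at_last (fun _ t => tr t \notin X)) `|`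
  (buchi_event upd z0 fin `&` @never_stuck _ _ M _ chain_upd chain_choice) `|`
  unlikely chain t0 `|`
  \bigcup_k lim_sup_set (fun n => ev n (at_last (good_since k))) `|`
  \bigcup_k ~` ev k.+1 predT.
Proof.
move=> w _; case: (pselect ((\bigcup_k ~` ev k.+1 predT) w)) => [|wfin]; first by right.
left; case: (pselect ((\bigcup_k lim_sup_set (fun n => ev n (at_last (good_since k)))) w))
  => [|ngs]; first by right.
left; case: (pselect (unlikely chain t0 w)) => [|lw]; first by right.
left; case: (pselect (ev n.+1 (at_last (fun _ t => tr t \notin X)) w)) => [|nNX]; first by left.
right; have winf : infinite_runs MC w.
  apply: (@lim_sup_ev_infinite _ _ MC (fun=> predT)) => k _; exists k.+1; first exact: leqnSn.
  by apply: contrapT => nk; apply: wfin; exists k.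
have /infinite_runsP[r wr] := winf.
have [r0 rP] := likely_run CW SW wr lw.
have rch i : (r i).2 = chain_choice (r i).1.1 (r i).1.2 by have [/eqP] := rP i.
have stepS i m : (r i).2 = Some m -> (r i.+1).1.2 = chain_upd (r i).1.1 (r i).1.2 /\
    0 < mdp_trans M (r i).1.1 m (r i.+1).1.1.
  move=> rm; have [_] := rP i; rewrite rm /=.
  by case: eqP => [-> //|_]; rewrite ltxx.
have stepN i : (r i).2 = None -> (r i.+1).1 = (r i).1.
  move=> rN; have [_] := rP i; rewrite rN /=.
  by case: eqP => // _; rewrite ltxx.
have Xstep i : tr (r i).1 \in X -> (r i).2 != None /\ tr (r i.+1).1 \in X.
  move=> iX; have [m [am /andP[_ /forallP saf] _]] := a_in iX.
  have rm : (r i).2 = Some m by rewrite rch /chain_choice iX.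
  have [y2 p0] := stepS i m rm; rewrite rm; split=> //.
  have := saf (tr (r i.+1).1); rewrite /tracked_trans/= y2/= eqxx p0 /=; exact.
have Xn : tr (r n).1 \in X.
  by apply: contrapT => /negP nX; apply: nNX; apply/(ev_run _ _ wr); rewrite mkseqS at_last_rcons.
have Xafter i : tr (r (i + n)%N).1 \in X by elim: i => // i /Xstep[].
have alive i : (r i).2 != None.
  case: (leqP n i) => ni; first by have := Xafter (i - n)%N; rewrite subnK// => /Xstep[].
  (* A self-loop keeps state and counter, so a run stuck before time [n] would still be stuck at
     [n], although [a] offers an action everywhere in [X]. *)
  apply/negP => /eqP rN.
  have rd k : (r (k + i)%N).1 = (r i).1.
    by elim: k => // k IH; rewrite addSn stepN// rch IH -rch.
  have rN' k : (r (k + i)%N).2 = None by rewrite rch rd -rch.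
  have [/negP nN _] := Xstep n Xn; apply: nN; apply/eqP.
  by have := rN' (n - i)%N; rewrite (subnK (ltnW ni)).
have zmem i : (r i).1.2.1 = memory_at upd z0 (fun k => mdp_lab MC (r k).1) i.
  elim: i => [|i IH]; first by rewrite r0.
  case E : ((r i).2) (alive i) => [m|]// _.
  by have [-> _] := stepS i m E; rewrite /= -IH.
split; last by apply/(never_stuckP wr).
apply/(buchi_eventP _ _ _ wr) => k; apply: contrapT => nf.
have nf' m : (k <= m)%N -> ~~ fin (r m).1.2.1.
  by move=> km; apply/negP => fm; apply: nf; exists m => //; rewrite -zmem.
have goodr m : (n + k <= m)%N -> good (r m).1.
  move=> nkm; rewrite /good nf' ?(leq_trans (leq_addl n k))// andbT.
  by have := Xafter (m - n)%N; rewrite subnK// (leq_trans (leq_addr k n)).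
apply: ngs; exists (n + k)%N => // l _; exists (l + (n + k)).+1; first exact: leqW (leq_addr _ _).
apply/(ev_run _ _ wr); rewrite mkseqS at_last_rcons /good_since size_mkseq leq_addl/=.
rewrite goodr ?leq_addl// andbT /mkseq -map_drop drop_iota; apply/allP => x /mapP[i].
by rewrite mem_iota => /andP[i1 _] ->; exact: goodr.
Qed.

(** The chain has total mass 1, of which the runs outside [X] at time [n] take at most
    [1 - value n (s0, z0)]; by the cover the rest lies in the event. *)
Lemma value_le_buchi : ((value n (s0, z0))%:E <=
  P (buchi_event upd z0 fin `&` @never_stuck _ _ M _ chain_upd chain_choice))%E.
Proof.
set E := _ `&` _; have mE : measurable E.
  by apply: measurableI; [exact: measurable_buchi|exact: measurable_never_stuck].
have PT1 := induced_le1 SW Pind.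
have Pf : (P setT < +oo)%E by exact: le_lt_trans PT1 (ltry _).
have ev1 k : P (ev k.+1 predT) = 1%E.
  by rewrite (measure_ev _ Pind.1)//; congr _%:E; apply: chain_total; [|exact: chain_choice_avail].
have T1 : P setT = 1%E.
  apply/eqP; rewrite eq_le PT1 -(ev1 0%N).
  by apply: measure_mono => //; exact: measurable_ev.
have fin0 : P (\bigcup_k ~` ev k.+1 predT) = 0%E.
  apply: measure_bigcup0 => k; first by apply: measurableC; exact: measurable_ev.
  have mev := measurable_ev (M := MC) k.+1 predT.
  have : P setT = (P (ev k.+1 predT) + P (~` ev k.+1 predT))%E.
    rewrite -measureU ?setUv ?setICr//; exact: measurableC.
  rewrite T1 ev1; case: (P (~` _)) => [x||]//=.
  by rewrite -EFinD => -[] x0; congr _%:E; lra.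
have gs0 : P (\bigcup_k lim_sup_set (fun n => ev n (at_last (good_since k)))) = 0%E.
  by apply: measure_bigcup0 => k; [exact: measurable_buchi|exact: good_since0].
pose NX := ev n.+1 (at_last (fun _ t => tr t \notin X)) : set (runSpace MC).
have mNX : measurable NX by exact: measurable_ev.
have mfin : measurable (\bigcup_k ~` ev k.+1 predT : set (runSpace MC)).
  by apply: bigcupT_measurable => k; apply: measurableC; exact: measurable_ev.
have mgs : measurable
    (\bigcup_k lim_sup_set (fun n => ev n (at_last (good_since k))) : set (runSpace MC)).
  by apply: bigcupT_measurable => k; exact: measurable_buchi.
have mun := measurable_unlikely chain t0.
have mNE : measurable (NX `|` E) by exact: measurableU.
have PNE : (P setT <= P (NX `|` E))%E.
  have mNEu := measurableU _ _ mNE mun.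
  have mNEg := measurableU _ _ mNEu mgs.
  apply: (le_trans _ (measure_le_null mNEu mNE mun (unlikely0 Pind) (fun _ => id))).
  apply: (le_trans _ (measure_le_null mNEg mNEu mgs gs0 (fun _ => id))).
  by apply: (measure_le_null _ mNEg mfin fin0) => //; exact: chain_runs_cover.
have := le_trans PNE (measure_leU P mNE mNX mE (fun _ => id)).
have PE := fin_num_finite_measure Pf mE.
move/le_trans => /(_ _ (leeD not_reached_bound (lexx _))); rewrite T1.
by case: (P E) PE => // x _; rewrite -EFinD !lee_fin; lra.
Qed.

End Lower.

End FiniteMemoryApproximation.
Lemma PSem_le_PSyn (R : realType) (Sigma : finType) (N : NBW Sigma) (M : MDP R Sigma) s0 :
  mdp_wf M ->
  (forall C : MDP R Sigma, mdp_wf C -> is_MC C -> forall t, PSyn C N t = PSem C N t) ->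
  (PSem M N s0 <= PSyn M N s0)%E.
Proof.
move=> Mwf GFMC; apply: ge_ereal_sup => _ [P [mu [muwf Pi]] <-].
(* One half of [e] pays for fixing [j], the other for fixing the deadline [n]. Both depend on [P],
   so each strategy gets its own chain. *)
apply/lee_addgt0Pr => e e0; have e20 : 0 < e / 2 by rewrite divr_gt0.
have Pf : (P setT < +oo)%E by exact: le_lt_trans (induced_le1 muwf Pi) (ltry _).
pose L j := \bigcap_(i in [set i | (j <= i)%N]) @bp_event _ _ M N i.
have mL j : measurable (L j).
  by apply: bigcap_measurable => [|i _]; [exists j => /=|exact: measurable_bp_event].
have ndL : {homo L : n m / (n <= m)%N >-> n `<=` m}.
  by move=> n m nm w Ln i /= mi; apply: Ln; exact: leq_trans mi.
have [j Lj] := measure_bigcup_approx Pf mL ndL e20.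
pose fin := @bp_final _ N j.
have [X [a [U [V [d [d0 [U01 V01] VX aX Vout]]]]]] :=
  buchi_region (@tracked_wf _ _ M Mwf _ (@bp_upd _ N j)) (fun t => fin t.2).
have [n nP] := buchi_le_value Mwf (bp_init N j) d0 V01 VX Vout muwf Pi e20.
pose y0 : bp_memory N j * 'I_n.+1 := (bp_init N j, ord_max).
pose ch := @chain_choice _ _ M _ (@bp_upd _ N j) X a n.
have chav s y m : ch s y = Some m -> mdp_avail M s m by exact: (chain_choice_avail aX).
pose C := memory_chain (chain_upd (M := M) (@bp_upd _ N j) (n := n)) ch.
have Cwf : mdp_wf C by exact: memory_chain_wf Mwf chav.
have [P' P'i] := exists_induced ((s0, y0) : mdp_st C) Cwf (@chain_strategy_wf _ _ _ _ _ _).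
have low := value_le_buchi Mwf d0 U01 aX P'i.
have syn := sem_never_stuck_le_PSyn Mwf chav P'i (GFMC C Cwf (@memory_chain_MC _ _ _ _ _ _) _).
have msem := @measurable_sem_event _ _ C N.
have mns := @measurable_never_stuck _ _ M _ (chain_upd (@bp_upd _ N j) (n := n)) ch.
have val : ((reach_value (@tracked_avail _ _ M _) (tracked_trans (@bp_upd _ N j)) X n
    (s0, bp_init N j))%:E <= PSyn M N s0)%E.
  apply: (le_trans low); apply: (le_trans _ syn); apply: measure_mono.
  - by apply: measurableI => //; exact: measurable_buchi.
  - exact: measurableI.
  - by move=> w [/bp_event_sub].
have Pbp : (P (L j) <= P (@bp_event _ _ M N j))%E.
  by apply: measure_mono => //; [exact: measurable_bp_event|move=> w /(_ j (leqnn j))].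
have Psem : (P (sem_event M N) <= P (\bigcup_j L j))%E.
  apply: measure_mono; [exact: measurable_sem_event|exact: bigcupT_measurable|].
  exact: sem_event_sub.
apply: (le_trans Psem); apply: (le_trans Lj).
apply: le_trans (leeD (le_trans Pbp nP) (lexx _)) _.
by rewrite EFinD -addeA -[X in (_ + X)%E]EFinD -splitr; apply: leeD.
Qed.

Theorem theorem3 (R : realType) (Sigma : finType) (N : NBW Sigma) :
  GFM R N <->
  (forall M : MDP R Sigma, mdp_wf M -> is_MC M ->
     forall s0 : mdp_st M, PSyn M N s0 = PSem M N s0).
Proof.
split=> [gfm M Mwf _|GFMC M Mwf] s0; first exact: gfm.
by apply/eqP; rewrite eq_le PSyn_le_PSem// PSem_le_PSyn.
Qed.
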